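(* Suppose that non-negative integers $p,q,s,t$ satisfy $$p+q=n,\quad s+t=d,\quad 0\le s\le p,\quad 0\le t\le q .$$ Then $$\mathcal{O}(p,q;s,t)=\{(\lambda_z,\xi)\in\Lambda\times\Xi_d\mid z\in\mathrm{Sym}_n(\mathbb{R}),\ \mathrm{sign}(z)=(p,q),\ \mathrm{sign}(\mathscr{Q}_{z^{-1}}|_\xi)=(s,t)\}$$ is an open $L$-orbit in $X=\Lambda\times\Xi_d$ (for the diagonal action of $L$). Every open $L$-orbit in $X$ is of this form.
   Context: Let $1\le d\le n-1$. Equip $V=\mathbb{R}^{2n}$ with the symplectic form $\langle u,v\rangle={}^tuJ_nv$, $J_n=\begin{pmatrix}0&-1_n\\1_n&0\end{pmatrix}$, and let $G=\mathrm{Sp}_{2n}(\mathbb{R})$ be its isometry group. Let $V^+$ be the span of the first $n$ standard basis vectors, $P_S=\mathrm{Stab}_G(V^+)$, and $L=\left\{\begin{pmatrix}a&0\\0&{}^ta^{-1}\end{pmatrix}\,\middle|\, a\in\mathrm{GL}_n(\mathbb{R})\right\}\simeq\mathrm{GL}_n(\mathbb{R})$. $\Lambda=G/P_S$ is identified with the set of Lagrangian subspaces of $V$, and $\Xi_d=\mathrm{Gr}_d(\mathbb{R}^n)$ is the Grassmannian of $d$-dimensional subspaces of $\mathbb{R}^n\simeq V^+$, which is $L/Q$ for a maximal parabolic subgroup $Q$ of $L$; $L$ acts on $\Lambda$ as a subgroup of $G$ and on $\Xi_d$ via $\mathrm{GL}_n(\mathbb{R})$. $\mathrm{Sym}_n(\mathbb{R})$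 is the space of real symmetric $n\times n$ matrices. For $z\in\mathrm{Sym}_n(\mathbb{R})$ let $\lambda_z=\left\{\begin{pmatrix}zx\\ x\end{pmatrix}\,\middle|\, x\in\mathbb{R}^n\right\}\in\Lambda$. For invertible $z\in\mathrm{Sym}_n(\mathbb{R})$, $\mathscr{Q}_{z^{-1}}(v,v)={}^tvz^{-1}v$ $(v\in\mathbb{R}^n)$. $\mathrm{sign}$ denotes the signature (number of positive, number of negative eigenvalues) of a symmetric matrix or quadratic form. *)

(* Defs.v *)
From HB Require Import structures.
From mathcomp Require Import all_boot all_order all_algebra.
From mathcomp Require Import all_classical all_reals all_analysis.

Set Implicit Arguments.
Unset Strict Implicit.
Unset Printing Implicit Defensive.

Import Order.TTheory GRing.Theory Num.Theory.
Import numFieldNormedType.Exports.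

Local Open Scope classical_set_scope.
Local Open Scope ring_scope.

(* Vectors are columns; a matrix A acts on subspaces by U |-> A U. *)
Notation mximg A U := (linfun (mulmx A) @: U)%VS.

(* Subsets of matrix spaces, used as types, carry the subset topology of
   [subtype_topology]. *)
Definition GL (R : realType) (n : nat) : set 'M[R]_n := [set a | a \in unitmx].
Arguments GL : clear implicits.

Section GeneralLinear.
Context {R : realType}.

Lemma GL_unit n (a : GL R n) : val a \in unitmx.
Proof. by case: a => a /= /set_mem. Qed.

Lemma dim_mximg m (A : 'M[R]_m) (U : {vspace 'cV[R]_m}) :
  A \in unitmx -> \dim (mximg A U) = \dim U.
Proof.
move=> uA; apply: limg_dim_eq; apply/eqP; rewrite -subv0; apply/subvP=> v.
rewrite memv_cap memv_ker lfunE /= => /andP[_ /eqP Av0].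
by rewrite memv0 -[v](mulKmx uA) Av0 mulmx0.
Qed.

End GeneralLinear.

Definition Jmx {R : realType} {n : nat} : 'M[R]_(n + n) :=
  block_mx 0 (- 1%:M) 1%:M 0.

Definition symp {R : realType} {n : nat} (u v : 'cV[R]_(n + n)) : R :=
  (u^T *m Jmx *m v) 0 0.

Definition Sp (R : realType) (n : nat) : set 'M[R]_(n + n) :=
  [set g | g \in unitmx /\ forall u v, symp (g *m u) (g *m v) = symp u v].
Arguments Sp : clear implicits.

Section Symplectic.
Context {R : realType} {n : nat}.

Definition is_lagrangian (U : {vspace 'cV[R]_(n + n)}) : Prop :=
  \dim U = n /\ forall u v, u \in U -> v \in U -> symp u v = 0.

Lemma levi_subproof (a : GL R n) :
  block_mx (val a) 0 0 (invmx (val a)^T) \in Sp R n.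
Proof.
have ua := GL_unit a; apply/mem_set; split.
  rewrite unitmxE det_ublock unitrM -!unitmxE ua /=.
  by rewrite unitmx_inv unitmx_tr.
move=> u v; rewrite /symp trmx_mul !mulmxA; congr ((_ *m _) 0 0).
rewrite -!mulmxA; congr (_ *m _).
rewrite /Jmx tr_block_mx !mulmx_block !trmx0 !(mul0mx, mulmx0, add0r, addr0).
by rewrite mul1mx mulNmx mul1mx mulmxN mulmxV ?unitmx_tr// trmx_inv trmxK mulVmx.
Qed.

(* The embedding of GL_n onto the Levi subgroup L of Sp_2n. *)
Definition levi (a : GL R n) : Sp R n :=
  SigSub (levi_subproof a).

Lemma sp_lagrangian (g : Sp R n) U :
  is_lagrangian U -> is_lagrangian (mximg (val g) U).
Proof.
case: g => g /= /set_mem[ug gJ] [dU iU]; split; first by rewrite dim_mximg.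
move=> _ _ /memv_imgP[u Uu ->] /memv_imgP[v Uv ->].
by rewrite !lfunE /= gJ iU.
Qed.

Definition Vplus : {vspace 'cV[R]_(n + n)} :=
  limg (linfun (mulmx (col_mx 1%:M 0 : 'M[R]_(n + n, n)))).

(* lambda z = { (z x, x) | x in R^n } *)
Definition lambda (z : 'M[R]_n) : {vspace 'cV[R]_(n + n)} :=
  limg (linfun (mulmx (col_mx z 1%:M))).

Lemma Vplus_lagrangian : is_lagrangian Vplus.
Proof.
split.
  rewrite limg_dim_eq; first by rewrite dimvf /dim /= muln1.
  apply/eqP; rewrite -subv0; apply/subvP=> v.
  rewrite memv_cap memv_ker lfunE /= mul_col_mx mul1mx mul0mx => /andP[_].
  by rewrite memv0 col_mx_eq0 eqxx andbT.
move=> _ _ /memv_imgP[u _ ->] /memv_imgP[v _ ->]; rewrite !lfunE /= /symp.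
rewrite !mul_col_mx !mul1mx !mul0mx tr_col_mx trmx0 /Jmx mul_row_block.
by rewrite !(mul0mx, mulmx0, addr0) mul_row_col !(mul0mx, mulmx0, add0r) mxE.
Qed.

End Symplectic.

Section Spaces.
Context (R : realType).

Definition lagr (n : nat) : Type :=
  {U : {vspace 'cV[R]_(n + n)} | `[< is_lagrangian U >]}.
HB.instance Definition _ n := SubChoice.on (lagr n).

Definition grass (d n : nat) : Type := {U : {vspace 'cV[R]_n} | \dim U == d}.
HB.instance Definition _ d n := SubChoice.on (grass d n).

Lemma lagr_act_subproof n (g : Sp R n) (U : lagr n) :
  `[< is_lagrangian (mximg (val g) (val U)) >].
Proof. by apply/asboolP/sp_lagrangian/asboolP; exact: (valP U). Qed.

Definition lagr_act n (g : Sp R n) (U : lagr n) : lagr n :=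
  Sub (mximg (val g) (val U)) (lagr_act_subproof g U).

Lemma grass_act_subproof d n (a : GL R n) (U : grass d n) :
  \dim (mximg (val a) (val U)) == d.
Proof. by rewrite dim_mximg ?GL_unit//; exact: (valP U). Qed.

Definition grass_act d n (a : GL R n) (U : grass d n) : grass d n :=
  Sub (mximg (val a) (val U)) (grass_act_subproof a U).

Definition lagr_base n : lagr n := Sub Vplus (asboolT Vplus_lagrangian).

(* Quotient topology of G / P_S, along the orbit map g |-> g V^+. *)
Definition lagr_open n (W : set (lagr n)) : Prop :=
  open [set g : Sp R n | W (lagr_act g (lagr_base n))].

Lemma lagr_openT n : lagr_open [set: lagr n].
Proof. exact: openT. Qed.

Lemma lagr_openI n : setI_closed (@lagr_open n).
Proof. by move=> A B oA oB; exact: openI. Qed.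

Lemma lagr_open_bigcup n (I : Type) (f : I -> set (lagr n)) :
  (forall i, lagr_open (f i)) -> lagr_open (\bigcup_i f i).
Proof. by move=> fo; apply: bigcup_open => i _; exact: fo. Qed.

HB.instance Definition _ n := isOpenTopological.Build (lagr n)
  (@lagr_openT n) (@lagr_openI n) (@lagr_open_bigcup n).

(* Quotient topology of GL_n / Stab(xi), along the orbit map a |-> a xi.  The
   action is transitive and right translations of GL_n are homeomorphisms, so
   the conditions for the various base points xi are equivalent; quantifying
   over xi avoids singling one out. *)
Definition grass_open d n (W : set (grass d n)) : Prop :=
  forall xi : grass d n, open [set a : GL R n | W (grass_act a xi)].

Lemma grass_openT d n : grass_open [set: grass d n].
Proof. by move=> xi; exact: openT. Qed.

Lemma grass_openI d n : setI_closed (@grass_open d n).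
Proof. by move=> A B oA oB xi; exact: (openI (oA xi) (oB xi)). Qed.

Lemma grass_open_bigcup d n (I : Type) (f : I -> set (grass d n)) :
  (forall i, grass_open (f i)) -> grass_open (\bigcup_i f i).
Proof. by move=> fo xi; apply: bigcup_open => i _; exact: fo. Qed.

HB.instance Definition _ d n := isOpenTopological.Build (grass d n)
  (@grass_openT d n) (@grass_openI d n) (@grass_open_bigcup d n).

End Spaces.

Section Signature.
Context {R : realType}.

(* Numbers of positive and of negative eigenvalues, counted with their
   multiplicity as roots of the characteristic polynomial; meant for symmetric
   matrices, all of whose eigenvalues are real. *)
Definition signature m (z : 'M[R]_m) : nat * nat :=
  (\sum_(a \in [set a : R | 0 < a]) mup a (char_poly z),
   \sum_(a \in [set a : R | a < 0]) mup a (char_poly z)).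

Definition bform n (y : 'M[R]_n) (u v : 'cV[R]_n) : R := (u^T *m y *m v) 0 0.

Definition gram n (y : 'M[R]_n) m (b : m.-tuple 'cV[R]_n) : 'M[R]_m :=
  \matrix_(i, j) bform y (tnth b i) (tnth b j).

(* Signature of the quadratic form v |-> v^T y v restricted to U, read off its
   matrix in a basis of U; by Sylvester's law of inertia the choice of basis
   is immaterial. *)
Definition restr_signature n (y : 'M[R]_n) (U : {vspace 'cV[R]_n}) :=
  signature (gram y (vbasis U)).

End Signature.

Section OpenOrbits.
Context (R : realType) (n d : nat).

Definition X : Type := (lagr R n * grass R d n)%type.
HB.instance Definition _ := Topological.on X.

Definition Lact (a : GL R n) (x : X) : X :=
  (lagr_act (levi a) x.1, grass_act a x.2).

Definition Lorbit (x : X) : set X := range (Lact ^~ x).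

Definition is_open_Lorbit (O : set X) : Prop :=
  open O /\ exists x, O = Lorbit x.

(* When p + q = n, the condition on the signature of z forces z to be
   invertible, so that [invmx z] is its inverse. *)
Definition Opqst (p q s t : nat) : set X :=
  [set x : X | exists z : 'M[R]_n,
     [/\ z^T = z, signature z = (p, q),
         restr_signature (invmx z) (val x.2) = (s, t) &
         val x.1 = lambda z]].

End OpenOrbits.

(* Main.v *)
Require Import Defs.
From mathcomp Require Import all_boot all_order all_algebra.
From mathcomp Require Import all_classical all_reals all_analysis.
From mathcomp Require Import perm spectral complex ring lra zify.

(** The action of a in GL_n carries lambda_z to lambda_(a z a^T), so a pair
    (lambda_z, xi) with z invertible amounts to the form y = z^-1 on R^n
    together with a d-dimensional subspace xi, taken up to change of basis.

    When y|xi is nondegenerate, R^n is the orthogonal sum of xi and its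
    y-orthogonal complement, and by Sylvester's law each summand is determined
    up to isometry by its signature.  The signature on the complement is that
    of y minus that of y|xi, so (sign z, sign y|xi) is a complete invariant
    ([flag_congr]), and every O(p,q;s,t) is a single orbit
    ([Opqst_Lorbit]).  Diagonal matrices with entries 1 and -1 show that all
    admissible values occur ([Opqst_neq0]).

    O(p,q;s,t) is open because the signature of a nondegenerate symmetric
    matrix is locally constant ([signature_near]): the matrix of y|xi in a
    moving basis depends continuously on z and on the translate of xi, and the
    sets of lambda_w with w near z, and of b xi with b near 1, are open in the
    two quotient topologies ([open_lambda], [open_translates]).

    Conversely, an orbit that is open meets the set of pairs with z invertible
    and y|xi nondegenerate, because two arbitrarily small symplectic shears
    bring any pair there ([open_generic]).  With (p,q) and (s,t) the
    signatures at such a point, inertia gives s <= p and t <= q, and the orbit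
    is O(p,q;s,t).

    The signature is defined by the eigenvalues of the matrix, whereas the
    argument above is about congruence of forms.  The real spectral theorem
    ([real_spectral]) joins the two: it turns the signature into counts of
    the signs on the diagonal ([signature_diag]), from which the inertia
    inequalities ([inertia_le]) and the classification up to congruence
    ([congr_signature]) follow. *)

Set Implicit Arguments.
Unset Strict Implicit.
Unset Printing Implicit Defensive.

Import Order.TTheory GRing.Theory Num.Theory.
Import numFieldNormedType.Exports.

Local Open Scope classical_set_scope.
Local Open Scope ring_scope.

(** * The real spectral theorem *)

Section Spectral.
Context {R : realType}.

Lemma trmx11 (a : 'M[R]_1) : a^T = a.
Proof. by apply/matrixP => i j; rewrite mxE !ord1. Qed.

Lemma dotE n (x : 'cV[R]_n) : (x^T *m x) 0 0 = \sum_i x i 0 ^+ 2.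
Proof. by rewrite mxE; apply: eq_bigr => i _; rewrite mxE expr2. Qed.

Lemma dot_ge0 n (x : 'cV[R]_n) : 0 <= (x^T *m x) 0 0.
Proof. by rewrite dotE sumr_ge0 // => i _; rewrite sqr_ge0. Qed.

Lemma dot_eq0 n (x : 'cV[R]_n) : ((x^T *m x) 0 0 == 0) = (x == 0).
Proof.
rewrite dotE psumr_eq0; last by move=> i _; rewrite sqr_ge0.
apply/allP/eqP => [x0|-> i _]; last by rewrite mxE expr0n eqxx.
apply/colP => i; rewrite mxE; apply/eqP; rewrite -sqrf_eq0.
by have := x0 i (mem_index_enum i).
Qed.

(** Over the complex numbers a real symmetric matrix is hermitian, so its
    eigenvalues are real, and they are then roots of the real characteristic
    polynomial. *)
Lemma sym_eigenvalue n (A : 'M[R]_n.+1) : A^T = A -> exists a, eigenvalue A a.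
Proof.
move=> sA; pose B : 'M[R[i]]_n.+1 := map_mx (real_complex R) A.
have hB : B \is hermsymmx.
  apply: realsym_hermsym.
    apply/is_hermitianmxP; rewrite expr0 scale1r map_mx_id // /B.
    by rewrite map_trmx sA.
  by apply/mxOverP => i j; rewrite mxE complex_real.
have /mxOverP/(_ 0 0) := hermitian_spectral_diag_real hB.
set a := _ 0 0 => ra.
have ea : eigenvalue B a.
  apply/eigenvalueP; exists (row 0 (spectralmx B)).
    have /orthomx_spectralP BE := hermitian_normalmx hB.
    rewrite -row_mul {2}BE !mulmxA mulmxV ?spectral_unit // mul1mx row_mul.
    by rewrite row_diag_mx -scalemxAl rowE.
  apply/eqP => r0; have := spectral_unit B.
  rewrite -row_free_unit => /row_freeP[C] /(congr1 (row 0)).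
  rewrite row_mul r0 mul0mx => /rowP/(_ 0); rewrite !mxE eqxx => /esym/eqP.
  by rewrite oner_eq0.
exists (complex.Re a); rewrite eigenvalue_root_char.
move: ea; rewrite eigenvalue_root_char -map_char_poly.
by rewrite -[a in root _ a]RRe_real // fmorph_root.
Qed.

(** Q is the reflection in the hyperplane orthogonal to u - e.  For u = e the
    coefficient 2 / s reads 2 / 0 = 0 and the same formula gives the
    identity. *)
Lemma householder n (e u : 'cV[R]_n) : e^T *m e = 1%:M -> u^T *m u = 1%:M ->
  exists Q : 'M[R]_n, [/\ Q^T = Q, Q *m Q = 1%:M & Q *m e = u].
Proof.
move=> e1 u1; pose w := u - e; pose s := (w^T *m w) 0 0; pose c := 2 / s.
have sw : w^T *m w = s%:M by rewrite [LHS]mx11_scalar.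
have cs : c * s = if w == 0 then 0 else 2.
  rewrite /c -dot_eq0 -/s; case: eqP => [->|/eqP s0]; first by rewrite mulr0.
  by rewrite divfK.
(* Both vectors are unit, so |u - e|^2 = 2 - 2 u.e = - 2 (u - e).e. *)
have we : w^T *m e = (- (s / 2))%:M.
  have eu : e^T *m u = u^T *m e by rewrite -[LHS]trmx11 trmx_mul trmxK.
  have ut : u^T *m e = ((u^T *m e) 0 0)%:M by rewrite [LHS]mx11_scalar.
  move: eu; rewrite ut; set t := (u^T *m e) 0 0 => eu.
  have st : s = 2 - t *+ 2.
    have := sw; rewrite /w !linearB /= !(mulmxBl, mulmxBr) e1 u1 eu ut -/t.
    by move=> /matrixP/(_ 0 0); rewrite !mxE /= !mulr1n => <-; ring.
  rewrite /w linearB /= mulmxBl e1 ut -/t st.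
  by apply/matrixP => i j; rewrite !mxE; field.
exists (1%:M - c *: (w *m w^T)); split.
- by rewrite linearB linearZ /= trmx1 trmx_mul trmxK.
- rewrite mulmxBl mul1mx mulmxBr mulmx1 -scalemxAl -scalemxAr scalerA.
  rewrite -mulmxA (mulmxA w^T) sw mul_scalar_mx -scalemxAr scalerA.
  have -> : c * c * s = c + c.
    rewrite -mulrA cs /c; case: eqP => [w0|_]; last by ring.
    by rewrite /s w0 trmx0 mul0mx mxE invr0 !mulr0 addr0.
  rewrite scalerDl; set W := c *: _.
  by rewrite opprB addrK subrK.
rewrite mulmxBl mul1mx -scalemxAl -mulmxA we mul_mx_scalar scalerA.
rewrite mulrN mulrA cs scaleNr opprK.
case: eqP => [w0|_]; last by rewrite divff ?pnatr_eq0 // scale1r /w addrC subrK.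
by rewrite mul0r scale0r addr0; move/eqP: w0; rewrite subr_eq0 => /eqP.
Qed.

(** A reflection moves the first basis vector to a unit eigenvector.  In the
    reflected matrix the first column is a multiple of that basis vector, by
    symmetry so is the first row, and the induction hypothesis applies to the
    remaining block. *)
Lemma real_spectral n (M : 'M[R]_n) : M^T = M ->
  exists (Q : 'M[R]_n) (d : 'rV[R]_n),
    Q^T *m Q = 1%:M /\ Q^T *m M *m Q = diag_mx d.
Proof.
elim: n M => [|n IHn] M sM.
  by exists 1%:M, 0; split; apply/matrixP => - [].
have [a /eigenvalueP[v vM v0]] := sym_eigenvalue sM.
pose r := (v *m v^T) 0 0.
have r0 : 0 < r.
  have vt0 : v^T != 0.
    by apply: contra_neq v0 => /(congr1 trmx); rewrite trmxK trmx0.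
  move: (dot_ge0 v^T) (dot_eq0 v^T); rewrite !trmxK -/r lt_neqAle eq_sym => -> ->.
  by rewrite vt0.
pose u := (Num.sqrt r)^-1 *: v^T.
have u1 : u^T *m u = 1%:M.
  have -> : u^T = (Num.sqrt r)^-1 *: v by rewrite /u linearZ /= trmxK.
  rewrite -scalemxAl -scalemxAr scalerA [_ *m _]mx11_scalar.
  rewrite -/r scale_scalar_mx -invfM -expr2 sqr_sqrtr ?ltW // mulVf //.
  by rewrite gt_eqF.
have Mu : M *m u = a *: u.
  by rewrite -scalemxAr -[M]trmxK -trmx_mul sM vM linearZ /= !scalerA mulrC.
pose e : 'cV[R]_(1 + n) := col_mx 1%:M 0.
have e1 : e^T *m e = 1%:M.
  by rewrite tr_col_mx mul_row_col trmx0 mulmx0 addr0 trmx1 mul1mx.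
have [H [sH HH He]] := householder e1 u1.
pose N : 'M[R]_(1 + n) := H *m M *m H.
have sN : N^T = N by rewrite /N !trmx_mul sM sH mulmxA.
have Ne : N *m e = a *: e.
  by rewrite /N -!mulmxA He Mu -scalemxAr -He mulmxA HH mul1mx.
have NE : N = block_mx a%:M 0 0 (drsubmx N).
  move: Ne sN; rewrite -[N]submxK tr_block_mx mul_block_col !mulmx1 !mulmx0 !addr0.
  rewrite scale_col_mx scaler0 => /eq_col_mx[-> ->] /eq_block_mx[_ <- _ _].
  by rewrite trmx0 block_mxKdr scalemx1.
have sN' : (drsubmx N)^T = drsubmx N by rewrite trmx_drsub sN.
have [P [d [PP Pd]]] := IHn _ sN'.
pose Q : 'M[R]_(1 + n) := block_mx 1%:M 0 0 P.
have QT : Q^T = block_mx 1%:M 0 0 P^T.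
  by rewrite /Q tr_block_mx !trmx0 trmx1.
have QQ : Q^T *m Q = 1%:M.
  rewrite QT /Q mulmx_block PP !(mul0mx, mulmx0, mulmx1, addr0, add0r).
  by rewrite -scalar_mx_block.
have QN : Q^T *m N *m Q = diag_mx (row_mx a%:M d).
  rewrite NE QT /Q !mulmx_block.
  rewrite !(mul0mx, mulmx0, mulmx1, mul1mx, addr0, add0r) Pd diag_mx_row.
  by congr block_mx; apply/matrixP => i j; rewrite !ord1 !mxE.
exists (H *m Q), (row_mx a%:M d); split.
  by rewrite trmx_mul sH mulmxA -[_ *m H *m H]mulmxA HH mulmx1.
by rewrite -QN /N trmx_mul sH !mulmxA.
Qed.

End Spectral.

(** * Eigenvalue signature and inertia *)

Section Inertia.
Context {R : realType}.

Lemma mup_prod n (d : 'I_n -> R) a :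
  mup a (\prod_i ('X - (d i)%:P)) = (\sum_i (d i == a))%N.
Proof.
suff [] : \prod_i ('X - (d i)%:P) != 0 /\
    mup a (\prod_i ('X - (d i)%:P)) = (\sum_i (d i == a))%N by [].
elim/big_ind2 : _ => [|x1 x2 y1 y2 [x0 <-] [y0 <-]|i _].
- by rewrite oner_eq0 mupNroot ?root1.
- by rewrite mulf_neq0 ?mupM.
- by rewrite polyXsubC_eq0 -[X in mup _ X]expr1 mup_XsubCX; case: eqP.
Qed.

(** Turns the sums over subsets of R in the definition of the signature into
    cardinals of sets of indices. *)
Lemma sum_mup n (d : 'I_n -> R) (P : pred R) :
  (\sum_(a \in [set` P]) mup a (\prod_i ('X - (d i)%:P)))%R = #|[pred i | P (d i)]|.
Proof.
pose r := undup [seq d i | i <- enum 'I_n].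
have dr i : d i \in r by rewrite mem_undup map_f ?mem_enum.
rewrite -(@bigfs _ _ _ _ r) ?undup_uniq //; last first.
  move=> a _ ar; rewrite mup_prod big1 // => i _.
  by case: eqP => // da; rewrite -da dr in ar.
under eq_bigr do rewrite mup_prod.
rewrite exchange_big /= -sum1_card [RHS]big_mkcond /=.
apply: eq_bigr => i _; rewrite inE big_mkcond (bigD1_seq (d i)) ?undup_uniq //=.
rewrite big1 => [|a ad]; first by rewrite eqxx addr0.
by rewrite eq_sym (negPf ad) if_same.
Qed.

Lemma char_poly_orth n (Q M : 'M[R]_n) : Q^T *m Q = 1%:M ->
  char_poly (Q^T *m M *m Q) = char_poly M.
Proof.
move=> QQ; rewrite /char_poly.
have -> : char_poly_mx (Q^T *m M *m Q) =
    map_mx polyC Q^T *m char_poly_mx M *m map_mx polyC Q.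
  rewrite /char_poly_mx mulmxBr mulmxBl -!map_mxM /=; congr (_ - _).
  by rewrite mul_mx_scalar -scalemxAl -map_mxM QQ map_mx1 scalemx1.
rewrite !det_mulmx mulrAC -det_mulmx -map_mxM QQ map_mx1.
by rewrite det1 mul1r.
Qed.

(** An orthogonal change of basis is at once a congruence and a similarity.
    As a similarity it keeps the characteristic polynomial, whose roots are
    then the diagonal entries. *)
Lemma signature_diag n (Q M : 'M[R]_n) (d : 'rV[R]_n) :
  Q^T *m Q = 1%:M -> Q^T *m M *m Q = diag_mx d ->
  signature M = (#|[pred i | 0 < d 0 i]|, #|[pred i | d 0 i < 0]|).
Proof.
move=> QQ QM; rewrite /signature -(char_poly_orth M QQ) QM.
have -> : char_poly (diag_mx d) = \prod_i ('X - (d 0 i)%:P).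
  rewrite char_poly_trig ?diag_mx_is_trig //.
  by apply: eq_bigr => i _; rewrite mxE eqxx mulr1n.
by rewrite (sum_mup (d 0) (fun a => 0 < a)) (sum_mup (d 0) (fun a => a < 0)).
Qed.

Lemma orth_diagK n (Q M : 'M[R]_n) (d : 'rV[R]_n) :
  Q^T *m Q = 1%:M -> Q^T *m M *m Q = diag_mx d -> M = Q *m diag_mx d *m Q^T.
Proof.
by move=> /mulmx1C QQ <-; rewrite !mulmxA QQ mul1mx -mulmxA QQ mulmx1.
Qed.

Lemma signatureN n (M : 'M[R]_n) : M^T = M ->
  signature (- M) = ((signature M).2, (signature M).1).
Proof.
move=> /real_spectral[Q [d [QQ QM]]]; rewrite (signature_diag QQ QM).
have QN : Q^T *m (- M) *m Q = diag_mx (- d) by rewrite mulmxN mulNmx QM linearN.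
rewrite (signature_diag QQ QN) /=.
by congr (_, _); apply: eq_card => i; rewrite !inE mxE ?oppr_gt0 ?oppr_lt0.
Qed.

Lemma diag_form n (d u : 'rV[R]_n) :
  (u *m diag_mx d *m u^T) 0 0 = \sum_i d 0 i * u 0 i ^+ 2.
Proof.
by rewrite mxE; apply: eq_bigr => i _; rewrite mul_mx_diag !mxE; ring.
Qed.

(** If k were larger than the number of positive eigenvalues, some nonzero x
    would give a vector x W without component along the eigenvectors of
    positive eigenvalue, and the form would be nonpositive on it. *)
Lemma pos_le_signature n k (M : 'M[R]_n) (W : 'M[R]_(k, n)) : M^T = M ->
  (forall x : 'rV_k, x != 0 -> 0 < (x *m (W *m M *m W^T) *m x^T) 0 0) ->
  (k <= (signature M).1)%N.
Proof.
move=> /real_spectral[Q [d [QQ QM]]] posW; rewrite (signature_diag QQ QM).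
pose P : {pred 'I_n} := [pred i | 0 < d 0 i]; rewrite [X in X.1]/= -/P.
(* x A lists the components of x W along the eigenvectors in P. *)
pose A : 'M[R]_(k, #|P|) := colsub (@enum_val _ P) (W *m Q).
rewrite leqNgt; apply/negP => kP.
have /rowV0Pn[x /sub_kermxP xA x0] : kermx A != 0.
  by rewrite -mxrank_eq0 -lt0n mxrank_ker subn_gt0 (leq_ltn_trans (rank_leq_col A)).
have := posW x x0; rewrite (orth_diagK QQ QM).
have -> : x *m (W *m (Q *m diag_mx d *m Q^T) *m W^T) *m x^T =
  (x *m (W *m Q)) *m diag_mx d *m (x *m (W *m Q))^T.
  by rewrite !trmx_mul !mulmxA.
rewrite diag_form ltNge => /negP; apply; apply: sumr_le0 => i _.
have [di|di] := leP (d 0 i) 0; first by rewrite mulr_le0_ge0 ?sqr_ge0.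
have Pi : i \in P by [].
suff <- : (x *m A) 0 (enum_rank_in Pi i) = (x *m (W *m Q)) 0 i.
  by rewrite xA mxE expr0n mulr0.
rewrite [LHS]mxE [RHS]mxE; apply: eq_bigr => j _.
by congr (_ * _); rewrite mxE enum_rankK_in.
Qed.

(** The rows of W are the eigenvectors of positive eigenvalue a, scaled by
    1 / sqrt a.  With [pos_le_signature] this characterizes the number of
    positive eigenvalues as the largest dimension of a positive definite
    subspace, a description that does not depend on the basis. *)
Lemma pos_frame n (M : 'M[R]_n) : M^T = M ->
  exists W : 'M[R]_((signature M).1, n), W *m M *m W^T = 1%:M.
Proof.
move=> /real_spectral[Q [d [QQ QM]]]; rewrite (signature_diag QQ QM).
pose P : {pred 'I_n} := [pred i | 0 < d 0 i]; rewrite [X in X.1]/= -/P.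
pose E : 'M[R]_(#|P|, n) :=
  \matrix_(k, i) ((i == enum_val k)%:R / Num.sqrt (d 0 i)).
exists (E *m Q^T).
have -> : E *m Q^T *m M *m (E *m Q^T)^T = E *m diag_mx d *m E^T.
  by rewrite -QM trmx_mul trmxK !mulmxA.
apply/matrixP => k l; rewrite mxE (bigD1 (enum_val k)) //= big1 => [|i ik].
  rewrite mul_mx_diag !mxE eqxx addr0 (inj_eq enum_val_inj).
  case: eqP => [_|_]; last by rewrite mul0r mulr0.
  have /= dk := enum_valP k; rewrite inE in dk.
  rewrite !mul1r mulrAC -invfM -expr2 sqr_sqrtr ?ltW // mulVf //.
  by rewrite gt_eqF.
by rewrite mul_mx_diag !mxE (negPf ik) !mul0r.
Qed.

End Inertia.

(** * Congruence of symmetric matrices *)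

Section Congruence.
Context {R : realType}.

Lemma sym_congr n k (P : 'M[R]_(n, k)) (M : 'M[R]_n) : M^T = M ->
  (P^T *m M *m P)^T = P^T *m M *m P.
Proof. by move=> sM; rewrite !trmx_mul trmxK sM mulmxA. Qed.

(** P carries a positive frame of P^T M P to a positive frame of M. *)
Lemma inertia_pos_le n k (P : 'M[R]_(n, k)) (M : 'M[R]_n) : M^T = M ->
  ((signature (P^T *m M *m P)).1 <= (signature M).1)%N.
Proof.
move=> sM; have [W WE] := pos_frame (sym_congr P sM).
apply: (pos_le_signature (W := W *m P^T)) => // x x0.
have -> : W *m P^T *m M *m (W *m P^T)^T = 1%:M.
  by rewrite -WE trmx_mul trmxK !mulmxA.
have xt0 : x^T != 0 by apply: contra_neq x0 => /(congr1 trmx); rewrite trmxK trmx0.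
have := dot_ge0 x^T; rewrite mulmx1 le_eqVlt eq_sym dot_eq0 (negPf xt0) /=.
by rewrite trmxK.
Qed.

(** The count of negative eigenvalues is the count of positive ones for
    - M. *)
Lemma inertia_le n k (P : 'M[R]_(n, k)) (M : 'M[R]_n) : M^T = M ->
  ((signature (P^T *m M *m P)).1 <= (signature M).1)%N /\
  ((signature (P^T *m M *m P)).2 <= (signature M).2)%N.
Proof.
move=> sM; split; first exact: inertia_pos_le.
have sN : (- M)^T = - M by rewrite linearN /= sM.
have := inertia_pos_le P sN; rewrite mulmxN mulNmx !signatureN //=.
exact: sym_congr.
Qed.

Lemma sylvester n (P M : 'M[R]_n) : M^T = M -> P \in unitmx ->
  signature (P^T *m M *m P) = signature M.
Proof.
move=> sM uP; have [le1 le2] := inertia_le P sM.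
have [] := inertia_le (invmx P) (sym_congr P sM).
rewrite !mulmxA -trmx_mul mulmxV // trmx1 mul1mx mulmxK //.
move: le1 le2; case: (signature _) => a b; case: (signature _) => a' b' /=.
by move=> *; congr (_, _); lia.
Qed.

Lemma orth_unit n (Q : 'M[R]_n) : Q^T *m Q = 1%:M -> Q \in unitmx.
Proof. by move=> /mulmx1_unit[]. Qed.

(** The determinant is the product of the eigenvalues, so M is invertible
    exactly when 0 is not one of them, that is, when the positive and the
    negative ones make up all n. *)
Lemma signature_sum n (M : 'M[R]_n) : M^T = M ->
  (((signature M).1 + (signature M).2)%N == n) = (M \in unitmx).
Proof.
move=> /real_spectral[Q [d [QQ QM]]]; rewrite (signature_diag QQ QM) /=.
rewrite (orth_diagK QQ QM) !unitmx_mul unitmx_tr orth_unit //= andbT.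
rewrite unitmxE det_diag unitfE prodf_seq_neq0.
set p := #|_|; set q := #|_|.
have -> : (p + q)%N = #|[pred i | d 0 i != 0]|.
  rewrite /p /q -cardUI [X in (_ + X)%N]eq_card0 ?addn0.
    by apply: eq_card => i; rewrite !inE /= orbC neq_lt.
  by move=> i; rewrite !inE /=; case: ltgtP.
apply/eqP/allP => [pn i _|d0].
  have /subset_cardP/(_ (subset_predT _))/(_ i) :
    #|[pred i | d 0 i != 0]| = #|'I_n| by rewrite pn card_ord.
  by rewrite !inE.
rewrite -[RHS]card_ord; apply: eq_card => i; rewrite !inE.
by have := d0 i (mem_index_enum i).
Qed.

(** The two tuples of truth values contain true equally often, hence are
    permutations of each other. *)
Lemma pred_perm n (a b : pred 'I_n) : #|a| = #|b| ->
  exists s : 'S_n, forall i, a (s i) = b i.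
Proof.
move=> ab; have : perm_eq [tuple b i | i < n] [tuple a i | i < n].
  have cnt (c : pred 'I_n) (P : pred bool) (r : seq 'I_n) :
      count P (map c r) =
      (P true * count c r + P false * (size r - count c r))%N.
    elim: r => //= [|i r ->]; first by rewrite !muln0.
    by have := count_size c r; case: (c i); case: (P true); case: (P false) => /=; lia.
  apply/seq.permP => P; rewrite !cnt.
  have enE (c : pred 'I_n) : count c (enum 'I_n) = #|c|.
    by rewrite cardE -size_filter /enum_mem filter_predT.
  by rewrite !enE ab.
move=> /tuple_permP[s sE]; exists s => i.
have := congr1 (fun t => nth false t i) sE.
by rewrite /= !nth_mktuple tnth_mktuple => <-.
Qed.

(** After orthogonal diagonalization of both matrices, a permutation s matches
    entries of equal sign, and each is rescaled to the other by the square root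
    of their quotient, which is positive. *)
Lemma congr_signature n (M N : 'M[R]_n) : M^T = M -> N^T = N ->
  M \in unitmx -> signature M = signature N ->
  exists2 P, P \in unitmx & P^T *m M *m P = N.
Proof.
move=> sM sN uM sMN.
have uN : N \in unitmx by rewrite -signature_sum // -sMN signature_sum.
have [Q [d [QQ QM]]] := real_spectral sM.
have [S [e [SS SN]]] := real_spectral sN.
have := sMN; rewrite (signature_diag QQ QM) (signature_diag SS SN) => -[de _].
have [s sE] := pred_perm de.
have nz (A T : 'M[R]_n) f : A \in unitmx -> T^T *m T = 1%:M ->
    T^T *m A *m T = diag_mx f -> forall i, f 0 i != 0.
  move=> uA TT TA i; have : diag_mx f \in unitmx.
    by rewrite -TA !unitmx_mul unitmx_tr uA orth_unit.
  by rewrite unitmxE det_diag unitfE prodf_seq_neq0 => /allP/(_ i (mem_index_enum i)).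
have d0 := nz _ _ _ uM QQ QM; have e0 := nz _ _ _ uN SS SN.
(* The permutation matrix of s with scaled columns. *)
pose Z : 'M[R]_n := \matrix_(j, i) ((j == s i)%:R * Num.sqrt (e 0 i / d 0 (s i))).
have ZE : Z^T *m diag_mx d *m Z = diag_mx e.
  apply/matrixP => i j; rewrite mxE (bigD1 (s i)) //= big1 => [|k ki].
    rewrite mul_mx_diag !mxE eqxx addr0 mul1r (inj_eq perm_inj).
    case: eqP => [<-|_]; last by rewrite mul0r mulr0.
    have es : 0 <= e 0 i / d 0 (s i).
      have /= := sE i; have [ei|ei] := ltP 0 (e 0 i) => di.
        by rewrite divr_ge0 ?ltW.
      by rewrite -mulrNN -invrN divr_ge0 ?oppr_ge0 // leNgt di.
    by rewrite mulr1n mul1r mulrAC -expr2 sqr_sqrtr // divfK.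
  by rewrite mul_mx_diag !mxE (negPf ki) !mul0r.
exists (Q *m Z *m S^T); last first.
  rewrite [RHS](orth_diagK SS SN) -ZE -QM !trmx_mul trmxK.
  by rewrite !mulmxA.
have : Z^T *m diag_mx d *m Z \in unitmx.
  by rewrite ZE -SN !unitmx_mul unitmx_tr uN orth_unit.
rewrite !unitmx_mul unitmx_tr => /andP[_ ->].
by rewrite unitmx_tr !orth_unit.
Qed.

Lemma signature_block m n (A : 'M[R]_m) (B : 'M[R]_n) : A^T = A -> B^T = B ->
  signature (block_mx A 0 0 B) =
  (((signature A).1 + (signature B).1)%N, ((signature A).2 + (signature B).2)%N).
Proof.
move=> /real_spectral[Q [d [QQ QM]]] /real_spectral[S [e [SS SN]]].
rewrite (signature_diag QQ QM) (signature_diag SS SN) /=.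
pose T := block_mx Q 0 0 S.
have TT : T^T *m T = 1%:M.
  rewrite /T tr_block_mx mulmx_block !trmx0 QQ SS !(mul0mx, mulmx0, addr0, add0r).
  by rewrite -scalar_mx_block.
rewrite (@signature_diag _ _ _ _ (row_mx d e) TT).
  have cardE (P : pred R) : #|[pred i | P (row_mx d e 0 i)]| =
      (#|[pred i | P (d 0%R i)]| + #|[pred i | P (e 0%R i)]|)%N.
    rewrite -!sum1_card big_split_ord /=; congr (_ + _)%N;
    by apply: eq_bigl => i; rewrite !inE ?row_mxEl ?row_mxEr.
  by rewrite (cardE (fun a => 0 < a)) (cardE (fun a => a < 0)).
rewrite /T tr_block_mx !mulmx_block !trmx0 !(mul0mx, mulmx0, addr0, add0r) QM SN.
by rewrite diag_mx_row.
Qed.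

End Congruence.

(** * Local constancy of the signature *)

Section Continuity.
Context {R : realType}.

(** Neighborhoods of a matrix are generated by products of neighborhoods of
    its finitely many entries. *)
Lemma cvg_mx T (F : set_system T) m n (f : T -> 'M[R]_(m, n)) (A : 'M[R]_(m, n)) :
  Filter F -> (forall i j, f x i j @[x --> F] --> A i j) -> f x @[x --> F] --> A.
Proof.
move=> FF fA U [P AP PU].
have : \forall x \near F, forall ij : 'I_m * 'I_n, P ij.1 ij.2 (f x ij.1 ij.2).
  by apply: filter_forall => -[i j] /=; exact: (fA i j _ (AP i j)).
by apply: filterS => x Px; apply: PU => i j; exact: (Px (i, j)).
Qed.

Lemma cvg_entry T (F : set_system T) m n (f : T -> 'M[R]_(m, n))
    (A : 'M[R]_(m, n)) i j : Filter F -> f x @[x --> F] --> A -> f x i j @[x --> F] --> A i j.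
Proof.
by move=> FF fA; exact: (cvg_comp _ _ fA (@coord_continuous _ _ _ i j A)).
Qed.

Lemma cvg_mulmx T (F : set_system T) m n p (f : T -> 'M[R]_(m, n))
    (g : T -> 'M[R]_(n, p)) (A : 'M[R]_(m, n)) (B : 'M[R]_(n, p)) : Filter F ->
  f x @[x --> F] --> A -> g x @[x --> F] --> B ->
  f x *m g x @[x --> F] --> A *m B.
Proof.
move=> FF fA gB; apply: cvg_mx => i j; rewrite mxE; under eq_cvg do rewrite mxE.
apply: cvg_big => [|k _]; first exact: add_continuous.
by apply: cvgM; exact: cvg_entry.
Qed.

Lemma cvg_det T (F : set_system T) n (f : T -> 'M[R]_n) (A : 'M[R]_n) : Filter F ->
  f x @[x --> F] --> A -> \det (f x) @[x --> F] --> \det A.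
Proof.
move=> FF fA; apply: cvg_big => [|s _]; first exact: add_continuous.
apply: cvgM; first exact: cvg_cst.
apply: cvg_big => [|k _]; first exact: mul_continuous.
exact: cvg_entry.
Qed.

Lemma near_unit n (A : 'M[R]_n) : A \in unitmx -> \forall M \near A, M \in unitmx.
Proof.
rewrite unitmxE unitfE => uA.
have detA : \det M @[M --> A] --> \det A.
  exact: (@cvg_det _ (nbhs A) n id A _ cvg_id).
have : \forall x \near \det A, x != 0.
  by apply: open_nbhs_nbhs; split; [exact: open_neq|].
move=> /detA; apply: (@filterS _ (nbhs A)) => M /=.
by rewrite unitmxE unitfE.
Qed.

(** By Cramer's rule the inverse is, near an invertible A, a quotient of
    polynomials in the entries. *)
Lemma cvg_invmx T (F : set_system T) n (f : T -> 'M[R]_n) (A : 'M[R]_n) : Filter F ->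
  A \in unitmx -> f x @[x --> F] --> A -> invmx (f x) @[x --> F] --> invmx A.
Proof.
move=> FF uA fA.
have fu : \forall x \near F, f x \in unitmx by exact: (fA _ (near_unit uA)).
suff H : (\det (f x))^-1 *: \adj (f x) @[x --> F] --> invmx A.
  apply: cvg_trans H; apply: near_eq_cvg; apply: filterS fu => x ux.
  by rewrite /invmx ux.
rewrite /invmx uA; apply: cvg_mx => i j; rewrite mxE; under eq_cvg do rewrite mxE.
apply: cvgM.
  by apply: cvgV; [rewrite -unitfE -unitmxE|exact: cvg_det].
rewrite mxE; under eq_cvg do rewrite mxE.
apply: cvgM; first exact: cvg_cst.
apply: cvg_det; apply: cvg_mx => k l; rewrite !mxE; under eq_cvg do rewrite !mxE.
exact: cvg_entry.
Qed.

(** With e = 1 / (k + 1), the estimate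
    |(N_ij - 1_ij) x_i x_j| <= e (x_i^2 + x_j^2) / 2 sums to an error of at
    most e k |x|^2, which is less than |x|^2. *)
Lemma near1_pos k (N : 'M[R]_k) (x : 'rV_k) :
  (forall i j, `|N i j - (i == j)%:R| < (k.+1%:R)^-1) -> x != 0 ->
  0 < (x *m N *m x^T) 0 0.
Proof.
move=> N1 x0; pose e : R := (k.+1%:R)^-1; pose S := \sum_i x 0 i ^+ 2.
have S0 : 0 < S.
  have xt0 : x^T != 0 by apply: contra_neq x0 => /(congr1 trmx); rewrite trmxK trmx0.
  rewrite lt_neqAle eq_sym sumr_ge0 ?andbT; last by move=> i _; exact: sqr_ge0.
  have <- : (x^T^T *m x^T) 0 0 = S by rewrite dotE; apply: eq_bigr => i _; rewrite mxE.
  by rewrite dot_eq0.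
have -> : (x *m N *m x^T) 0 0 = \sum_i \sum_j x 0 i * N i j * x 0 j.
  rewrite mxE exchange_big; apply: eq_bigr => j _.
  by rewrite !mxE mulr_suml.
have : S - e * k%:R * S <= \sum_i \sum_j x 0 i * N i j * x 0 j.
  have -> : S - e * k%:R * S = \sum_i \sum_j
     ((i == j)%:R * x 0 i * x 0 j - e * (x 0 i ^+ 2 + x 0 j ^+ 2) / 2).
    under eq_bigr do rewrite sumrB.
    rewrite sumrB; congr (_ - _).
      apply: eq_bigr => i _; rewrite (bigD1 i) //= big1 => [|j ji].
        by rewrite eqxx mul1r addr0 expr2.
      by rewrite eq_sym (negPf ji) !mul0r.
    under [RHS]eq_bigr do rewrite -mulr_suml -mulr_sumr big_split /=.
    rewrite -mulr_suml -mulr_sumr big_split /=.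
    under [X in X + _]eq_bigr do rewrite sumr_const card_ord.
    rewrite sumr_const card_ord -/S sumrMnl -/S -mulr_natr.
    by field.
  apply: ler_sum => i _; apply: ler_sum => j _.
  have := N1 i j; rewrite -/e ltr_norml => /andP[N1l N1r].
  have q1 := sqr_ge0 (x 0 i - x 0 j); have q2 := sqr_ge0 (x 0 i + x 0 j).
  set a := x 0 i in q1 q2 *; set b := x 0 j in q1 q2 *.
  set d := N i j - _ in N1l N1r.
  have -> : N i j = d + (i == j)%:R by rewrite /d subrK.
  have : - (e * (a ^+ 2 + b ^+ 2) / 2) <= a * d * b; last lra.
  (* The sum of p1 and p2 is 2 e (a^2 + b^2) + 4 a d b. *)
  have p1 : 0 <= (e + d) * (a + b) ^+ 2 by rewrite mulr_ge0 //; lra.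
  have p2 : 0 <= (e - d) * (a - b) ^+ 2 by rewrite mulr_ge0 //; lra.
  by lra.
apply: lt_le_trans; rewrite -[X in X - _]mul1r -mulrBl mulr_gt0 //.
by rewrite subr_gt0 /e mulrC ltr_pdivrMr ?ltr0n // mul1r ltr_nat.
Qed.

(** A frame W with W M0 W^T = 1 still has W M W^T close to 1, hence positive
    definite, for M near M0. *)
Lemma near_pos n (M0 : 'M[R]_n) : M0^T = M0 -> \forall M \near M0,
  M^T = M -> ((signature M0).1 <= (signature M).1)%N.
Proof.
move=> /pos_frame; set k := (signature M0).1 => -[W WE].
have : W *m M *m W^T @[M --> M0] --> W *m M0 *m W^T.
  apply: (@cvg_mulmx _ (nbhs M0)); last exact: cvg_cst.
  by apply: (@cvg_mulmx _ (nbhs M0)); [exact: cvg_cst|exact: cvg_id].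
rewrite WE => cW.
have kp : 0 < (k.+1%:R : R)^-1 by rewrite invr_gt0 ltr0n.
have := cW _ (nbhsx_ballx _ _ kp).
apply: (@filterS _ (nbhs M0)) => M [_ WM] sM.
apply: (@pos_le_signature _ _ _ _ W) => // x x0.
apply: near1_pos => // i j.
by have := WM i j; rewrite -ball_normE /= distrC [X in _ - X]mxE.
Qed.

(** Near M0 neither count can drop, and their sum already has the maximal
    value n, so neither can grow. *)
Lemma signature_near n (M0 : 'M[R]_n) : M0^T = M0 -> M0 \in unitmx ->
  \forall M \near M0, M^T = M -> signature M = signature M0.
Proof.
move=> sM0 uM0.
have N : - M @[M --> M0] --> - M0 by exact: opp_continuous.
have sN0 : (- M0)^T = - M0 by rewrite linearN /= sM0.
have H := N _ (near_pos sN0).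
apply: (@filterS _ (nbhs M0)) (filterI (filterI (near_pos sM0) H) (near_unit uM0)).
move=> M [[H1 H2] uM] sM.
have sN : (- M)^T = - M by rewrite linearN /= sM.
have : ((signature M0).2 <= (signature M).2)%N.
  by have := H2 sN; rewrite !signatureN.
move: uM uM0 (H1 sM); rewrite -!signature_sum // => /eqP + /eqP.
case: (signature M) => a b; case: (signature M0) => a' b' /= *.
by congr (_, _); lia.
Qed.

End Continuity.

(** * Column spaces and Lagrangian subspaces *)

Section ColumnSpaces.
Context {R : realType}.

(** Subspaces are handled through matrices whose columns span them; that the
    columns of F are independent is expressed by [row_free F^T].  Both
    [lambda z] and [Vplus] are of this form by definition. *)
Definition colspan n k (F : 'M[R]_(n, k)) : {vspace 'cV[R]_n} :=
  limg (linfun (mulmx F)).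

Lemma colspanP n k (F : 'M[R]_(n, k)) v :
  reflect (exists x, v = F *m x) (v \in colspan F).
Proof.
apply: (iffP memv_imgP) => [[x _ ->]|[x ->]]; first by exists x; rewrite lfunE.
by exists x; rewrite ?memvf ?lfunE.
Qed.

Lemma mximg_colspan n k (g : 'M[R]_n) (F : 'M[R]_(n, k)) :
  mximg g (colspan F) = colspan (g *m F).
Proof.
apply/vspaceP => v; apply/memv_imgP/colspanP => [[u /colspanP[x ->] ->]|[x ->]].
  by exists x; rewrite lfunE /= mulmxA.
by exists (F *m x); [apply/colspanP; exists x|rewrite lfunE /= mulmxA].
Qed.

Lemma colspan_mul n k l (F : 'M[R]_(n, k)) (P : 'M[R]_(k, l)) :
  (colspan (F *m P) <= colspan F)%VS.
Proof.
by apply/subvP => _ /colspanP[x ->]; apply/colspanP; exists (P *m x); rewrite mulmxA.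
Qed.

Lemma colspan_mul_unit n k (F : 'M[R]_(n, k)) (P : 'M[R]_k) : P \in unitmx ->
  colspan (F *m P) = colspan F.
Proof.
move=> uP; apply: subv_anti; rewrite colspan_mul /=.
by rewrite -{1}[F](mulmxK uP) colspan_mul.
Qed.

Lemma colspan_sub n k l (F : 'M[R]_(n, k)) (G : 'M[R]_(n, l)) :
  (colspan F <= colspan G)%VS -> exists P, F = G *m P.
Proof.
move=> /subvP FG; have /choice[f fE] j : exists x, col j F = G *m x.
  by apply/colspanP/FG/colspanP; exists (delta_mx j 0); rewrite colE.
exists (\matrix_(i, j) f j i 0); apply/matrixP => i j.
have /colP/(_ i) := fE j; rewrite !mxE => ->.
by apply: eq_bigr => p _; rewrite !mxE.
Qed.

(** Each of F and G is a multiple of the other, and the left inverse that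
    independence provides makes the two factors inverse to each other. *)
Lemma colspan_eq n k (F G : 'M[R]_(n, k)) :
  row_free G^T -> row_free F^T -> colspan F = colspan G ->
  exists2 P, P \in unitmx & F = G *m P.
Proof.
move=> fG fF FG.
have [P FP] : exists P, F = G *m P by apply: colspan_sub; rewrite FG.
have [Q GQ] : exists Q, G = F *m Q by apply: colspan_sub; rewrite FG.
exists P => //; have [L] := row_freeP fG; move=> /(congr1 trmx).
rewrite trmx_mul trmxK trmx1 => LG.
have := LG; rewrite {1}GQ FP -!mulmxA (mulmxA L^T) LG mul1mx => PQ.
by have [] := mulmx1_unit PQ.
Qed.

Lemma dim_colspan n k (F : 'M[R]_(n, k)) : row_free F^T -> \dim (colspan F) = k.
Proof.
move=> /row_freeP[L /(congr1 trmx)]; rewrite trmx_mul trmxK trmx1 => LF.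
rewrite limg_dim_eq; first by rewrite dimvf /dim /= muln1.
apply/eqP; rewrite -subv0; apply/subvP => v.
rewrite memv_cap memv_ker lfunE /= => /andP[_ /eqP Fv0].
by rewrite memv0 -[v]mul1mx -LF -mulmxA Fv0 mulmx0.
Qed.

Definition basis_mx n (U : {vspace 'cV[R]_n}) : 'M[R]_(n, \dim U) :=
  \matrix_(i, j) tnth (vbasis U) j i 0.

Lemma basis_mx_mul n (U : {vspace 'cV[R]_n}) x :
  basis_mx U *m x = \sum_j x j 0 *: tnth (vbasis U) j.
Proof.
apply/colP => i; rewrite mxE summxE; apply: eq_bigr => j _.
by rewrite !mxE mulrC.
Qed.

Lemma colspan_basis_mx n (U : {vspace 'cV[R]_n}) : colspan (basis_mx U) = U.
Proof.
apply/vspaceP => v; apply/colspanP/idP => [[x ->]|vU].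
  rewrite basis_mx_mul; apply: memv_suml => j _; apply: memvZ.
  exact/vbasis_mem/mem_tnth.
exists (\col_j coord (vbasis U) j v).
rewrite basis_mx_mul {1}(coord_vbasis vU); apply: eq_bigr => j _.
by rewrite mxE (tnth_nth 0).
Qed.

Lemma basis_mx_free n (U : {vspace 'cV[R]_n}) : row_free (basis_mx U)^T.
Proof.
rewrite -kermx_eq0; apply/rowV0P => x /sub_kermxP xU.
have : basis_mx U *m x^T = 0 by rewrite -[basis_mx U]trmxK -trmx_mul xU trmx0.
rewrite basis_mx_mul => s0; apply/rowP => j; rewrite [RHS]mxE.
have /freeP/(_ (fun j => x 0 j)) := basis_free (vbasisP U); apply.
by rewrite -[RHS]s0; apply: eq_bigr => k _; rewrite mxE (tnth_nth 0).
Qed.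

Lemma form_col n k (y : 'M[R]_n) (F : 'M[R]_(n, k)) i j :
  ((col i F)^T *m y *m col j F) 0 0 = (F^T *m y *m F) i j.
Proof.
rewrite tr_col -row_mul [LHS]mxE [RHS]mxE.
by apply: eq_bigr => l _; rewrite !mxE.
Qed.

Lemma gram_vbasis n (y : 'M[R]_n) (U : {vspace 'cV[R]_n}) :
  gram y (vbasis U) = (basis_mx U)^T *m y *m basis_mx U.
Proof.
apply/matrixP => i j; rewrite mxE /bform.
have colU k : tnth (vbasis U) k = col k (basis_mx U) by apply/colP => l; rewrite !mxE.
by rewrite !colU form_col.
Qed.

(** By Sylvester's law any basis F of the subspace may replace the basis used
    in the definition. *)
Lemma restr_signature_colspan n k (y : 'M[R]_n) (F : 'M[R]_(n, k)) :
  y^T = y -> row_free F^T -> restr_signature y (colspan F) = signature (F^T *m y *m F).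
Proof.
move=> sy fF; have := colspan_basis_mx (colspan F); have := basis_mx_free (colspan F).
rewrite /restr_signature gram_vbasis; move: (basis_mx (colspan F)).
rewrite dim_colspan // => E fE EF.
have [P uP ->] := colspan_eq fE fF (esym EF).
have -> : (E *m P)^T *m y *m (E *m P) = P^T *m (E^T *m y *m E) *m P.
  by rewrite trmx_mul !mulmxA.
by rewrite sylvester ?sym_congr.
Qed.

Lemma colspan_ex n k (U : {vspace 'cV[R]_n}) : \dim U = k ->
  exists2 F : 'M[R]_(n, k), row_free F^T & U = colspan F.
Proof. by move=> <-; exists (basis_mx U); rewrite ?colspan_basis_mx ?basis_mx_free. Qed.

(** x^T (F^T F) x = |F x|^2, so F^T F has trivial kernel. *)
Lemma gram_unit n k (F : 'M[R]_(n, k)) : row_free F^T -> F^T *m F \in unitmx.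
Proof.
move=> fF; rewrite -row_free_unit -kermx_eq0; apply/rowV0P => x /sub_kermxP xF.
have : ((F *m x^T)^T *m (F *m x^T)) 0 0 == 0.
  by rewrite trmx_mul trmxK -mulmxA (mulmxA F^T) mulmxA xF mul0mx mxE.
rewrite dot_eq0 => /eqP/(congr1 trmx); rewrite trmx_mul trmxK trmx0 => xF0.
by apply: (row_free_inj fF); rewrite xF0 mul0mx.
Qed.

End ColumnSpaces.

Section Lagrangians.
Context {R : realType}.

Lemma Jmx_mul n k (A C : 'M[R]_(n, k)) : Jmx *m col_mx A C = col_mx (- C) A.
Proof. by rewrite /Jmx mul_block_col !mul0mx mulNmx !mul1mx add0r addr0. Qed.

Lemma Jmx_form n k (A C : 'M[R]_(n, k)) :
  (col_mx A C)^T *m Jmx *m col_mx A C = C^T *m A - A^T *m C.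
Proof. by rewrite -mulmxA Jmx_mul tr_col_mx mul_row_col mulmxN addrC. Qed.

Lemma colspan_lagrangian n (A C : 'M[R]_n) : row_free (col_mx A C)^T ->
  A^T *m C = C^T *m A -> is_lagrangian (colspan (col_mx A C)).
Proof.
move=> fF AC; split=> [|_ _ /colspanP[x ->] /colspanP[y ->]]; first exact: dim_colspan.
rewrite /symp trmx_mul !mulmxA -(mulmxA x^T) -(mulmxA x^T) Jmx_form AC subrr.
by rewrite mulmx0 mul0mx mxE.
Qed.

Lemma lagrangian_form n k (F : 'M[R]_(n + n, k)) :
  is_lagrangian (colspan F) -> F^T *m Jmx *m F = 0.
Proof.
move=> [_ iF]; apply/matrixP => i j; rewrite [RHS]mxE -form_col.
apply: iF; apply/colspanP; first by exists (delta_mx i 0); rewrite colE.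
by exists (delta_mx j 0); rewrite colE.
Qed.

Lemma lagr_basis n (U : lagr R n) : exists A C : 'M[R]_n,
  [/\ row_free (col_mx A C)^T, val U = colspan (col_mx A C) & A^T *m C = C^T *m A].
Proof.
have /asboolP lU := valP U; have [F fF UF] := colspan_ex lU.1.
exists (usubmx F), (dsubmx F); rewrite vsubmxK; split => //.
have := lU; rewrite UF => /lagrangian_form; rewrite -{1 2}[F]vsubmxK Jmx_form => /eqP.
by rewrite subr_eq0 => /eqP.
Qed.

Lemma lambda_lagr_sym n (z : 'M[R]_n) : is_lagrangian (lambda z) -> z^T = z.
Proof.
move=> /lagrangian_form; rewrite Jmx_form trmx1 mul1mx mulmx1 => /eqP.
by rewrite subr_eq0 => /eqP.
Qed.

(** The relation g^T J g = J makes - J g^T J a left inverse of g. *)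
Lemma Sp_congr n (g : 'M[R]_(n + n)) : g^T *m Jmx *m g = Jmx -> g \in Sp R n.
Proof.
move=> gJ; apply/mem_set; split; last first.
  by move=> u v; rewrite /symp trmx_mul -[in RHS]gJ !mulmxA.
have JJ : (- Jmx) *m Jmx = 1%:M :> 'M[R]_(n + n).
  rewrite mulNmx /Jmx mulmx_block !(mul0mx, mulmx0, addr0, add0r) !mul1mx mulmx1.
  by rewrite opp_block_mx opprK !oppr0 -scalar_mx_block.
have [] // := @mulmx1_unit _ _ (- Jmx *m g^T *m Jmx) g.
by rewrite -[RHS]JJ -{4}gJ !mulmxA.
Qed.

(** If the columns of F form a basis of U, those of J F (F^T F)^-1 span a
    complementary Lagrangian, and together they form a symplectic basis.
    Without transitivity the orbit map from V^+ would say nothing about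
    neighborhoods of a point outside its image. *)
Lemma lagr_transitive n (U : lagr R n) :
  exists g : Sp R n, U = lagr_act g (lagr_base R n).
Proof.
have [A [C [fF UF AC]]] := lagr_basis U.
set F := col_mx A C in fF UF; pose K := invmx (F^T *m F).
have uK := gram_unit fF.
have sK : K^T = K by rewrite /K trmx_inv trmx_mul trmxK.
have JF : Jmx *m F = col_mx (- C) A by exact: Jmx_mul.
have JJF : Jmx *m (Jmx *m F) = - F by rewrite JF Jmx_mul -opp_col_mx.
have FJF : F^T *m Jmx *m F = 0.
  by rewrite Jmx_form AC subrr.
have JT : Jmx^T = - Jmx :> 'M[R]_(n + n).
  by rewrite /Jmx tr_block_mx !trmx0 linearN /= trmx1 opp_block_mx opprK !oppr0.
pose G := Jmx *m F.
have JG : Jmx *m G = - F by [].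
have GT : G^T = - (F^T *m Jmx) by rewrite /G trmx_mul JT mulmxN.
pose g := row_mx F (G *m K).
have gS : g \in Sp R n.
  apply: Sp_congr; rewrite -mulmxA /g tr_row_mx mul_mx_row mul_col_row [RHS]/Jmx.
  congr block_mx.
  - by rewrite mulmxA.
  - by rewrite (mulmxA Jmx) JG mulNmx mulmxN mulmxA mulmxV.
  - rewrite trmx_mul sK GT mulmxN mulNmx -!mulmxA -/G JG !mulmxN opprK.
    by rewrite mulVmx.
  - rewrite trmx_mul sK GT (mulmxA Jmx) JG mulNmx !(mulmxN, mulNmx) opprK.
    by rewrite -mulmxA (mulmxA _ F) FJF mul0mx mulmx0.
exists (SigSub gS); apply/val_inj; rewrite /= UF /Vplus -/(colspan _).
by rewrite mximg_colspan // /g mul_row_col mulmx1 mulmx0 addr0.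
Qed.

(** The pair (a z x, a^-T x) is (a z a^T x', x') for x' = a^-T x. *)
Lemma levi_lambda n (a : GL R n) (z : 'M[R]_n) :
  mximg (val (levi a)) (lambda z) = lambda (val a *m z *m (val a)^T).
Proof.
have ua := Defs.GL_unit a.
rewrite /lambda -!/(colspan _) mximg_colspan //= mul_block_col.
rewrite !mul0mx add0r addr0 mulmx1.
rewrite -[RHS](@colspan_mul_unit _ _ _ _ (invmx (val a)^T)) ?unitmx_inv ?unitmx_tr //.
by rewrite mul_col_mx mul1mx mulmxK ?unitmx_tr.
Qed.

Lemma col_mx1_free n (z : 'M[R]_n) : row_free (col_mx z 1%:M)^T.
Proof.
apply/row_freeP; exists (col_mx 0 1%:M).
by rewrite tr_col_mx mul_row_col mulmx0 trmx1 mulmx1 add0r.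
Qed.

Lemma colspan_lambda n (A C : 'M[R]_n) : C \in unitmx ->
  colspan (col_mx A C) = lambda (A *m invmx C).
Proof.
move=> uC; rewrite /lambda -/(colspan _) -[RHS](colspan_mul_unit _ uC).
by rewrite mul_col_mx mul1mx mulmxKV.
Qed.

(** The subspaces lambda_z are those on which the second component is a
    coordinate. *)
Lemma lambda_colspan n (A C z : 'M[R]_n) : row_free (col_mx A C)^T ->
  colspan (col_mx A C) = lambda z -> C \in unitmx /\ A *m invmx C = z.
Proof.
move=> fF; rewrite /lambda -/(colspan _) => FE.
have [P uP] := colspan_eq (col_mx1_free z) fF FE.
by rewrite mul_col_mx mul1mx => /eq_col_mx[-> ->]; rewrite mulmxK.
Qed.

End Lagrangians.

(** * O(p,q;s,t) is a single orbit *)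

Section Orbits.
Context {R : realType}.

Lemma complement_basis n d m (A : 'M[R]_(n, d)) : n = (d + m)%N -> row_free A^T ->
  exists2 K : 'M[R]_(m, n), row_free K & K *m A = 0.
Proof.
move=> nE fA; pose K0 := kermx A.
have rK : \rank K0 = m.
  by rewrite mxrank_ker -mxrank_tr (eqP fA) nE addKn.
have fK : row_free (row_base K0) by rewrite row_base_free.
have KA : row_base K0 *m A = 0.
  by apply/sub_kermxP; rewrite eq_row_base.
by move: (row_base K0) fK KA; rewrite rK => K fK KA; exists K.
Qed.

(** K spans the y-orthogonal complement of the span of E, which is a direct
    complement because y is nondegenerate on that span. *)
Lemma adapted_basis d m (y : 'M[R]_(d + m)) (E : 'M[R]_(d + m, d)) :
  y^T = y -> y \in unitmx -> row_free E^T -> E^T *m y *m E \in unitmx ->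
  exists K : 'M[R]_(d + m, m), row_mx E K \in unitmx /\
    (row_mx E K)^T *m y *m row_mx E K =
      block_mx (E^T *m y *m E) 0 0 (K^T *m y *m K).
Proof.
move=> sy uy fE uG.
have fyE : row_free (y *m E)^T.
  by rewrite trmx_mul sy /row_free mxrankMfree // row_free_unit.
have [K fK KyE] := complement_basis erefl fyE.
have EyK : E^T *m y *m K^T = 0.
  have := congr1 trmx KyE; rewrite trmx0 => <-.
  by rewrite !trmx_mul sy.
exists K^T; split; last first.
  rewrite tr_row_mx mul_col_mx mul_col_row trmxK EyK.
  by rewrite -(mulmxA K) KyE.
rewrite -unitmx_tr -row_free_unit -kermx_eq0; apply/rowV0P => x /sub_kermxP.
rewrite -[x]hsubmxK tr_row_mx trmxK mul_row_col.
set a := lsubmx x; set b := rsubmx x => ab0.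
have a0 : a = 0.
  have := congr1 (mulmx^~ (y *m E)) ab0.
  rewrite mul0mx mulmxDl -(mulmxA b) KyE mulmx0 addr0 -mulmxA (mulmxA E^T).
  move=> /(congr1 (mulmx^~ (invmx (E^T *m y *m E)))).
  by rewrite mulmxK // mul0mx.
move: ab0; rewrite a0 mul0mx add0r => bK; suff -> : b = 0 by rewrite row_mx0.
by apply: (row_free_inj fK); rewrite bK mul0mx.
Qed.

(** In bases adapted to E and E' both forms are block diagonal.  The blocks on
    the subspaces are congruent by assumption, and those on the complements
    because their signatures are what remains of equal totals. *)
Lemma flag_congr d m (y y' : 'M[R]_(d + m)) (E E' : 'M[R]_(d + m, d)) :
  y^T = y -> y'^T = y' -> y \in unitmx -> signature y = signature y' ->
  row_free E^T -> row_free E'^T -> E^T *m y *m E \in unitmx ->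
  signature (E^T *m y *m E) = signature (E'^T *m y' *m E') ->
  exists a : 'M[R]_(d + m), [/\ a \in unitmx, a^T *m y' *m a = y &
    colspan (a *m E) = colspan E'].
Proof.
move=> sy sy' uy yy' fE fE' uG GG'.
have uy' : y' \in unitmx by rewrite -signature_sum // -yy' signature_sum.
have sG := sym_congr E sy; have sG' := sym_congr E' sy'.
have uG' : E'^T *m y' *m E' \in unitmx by rewrite -signature_sum // -GG' signature_sum.
have [K [uB BE]] := adapted_basis sy uy fE uG.
have [K' [uB' BE']] := adapted_basis sy' uy' fE' uG'.
set B := row_mx E K in uB BE; set B' := row_mx E' K' in uB' BE'.
have sH := sym_congr K sy; have sH' := sym_congr K' sy'.
have HH' : signature (K'^T *m y' *m K') = signature (K^T *m y *m K).
  have e := sylvester sy uB; have e' := sylvester sy' uB'.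
  move: e e'; rewrite BE BE' !signature_block // -yy' GG' => <- e.
  have /addnI e1 := congr1 fst e; have /addnI e2 := congr1 snd e.
  by rewrite [LHS]surjective_pairing e1 e2 -surjective_pairing.
have uH' : K'^T *m y' *m K' \in unitmx.
  have : block_mx (E'^T *m y' *m E') 0 0 (K'^T *m y' *m K') \in unitmx.
    by rewrite -BE' !unitmx_mul unitmx_tr uB' uy'.
  by rewrite unitmxE det_ublock unitrM -!unitmxE => /andP[].
have [P uP PE] := congr_signature sG' sG uG' (esym GG').
have [Q uQ QE] := congr_signature sH' sH uH' HH'.
pose D := block_mx P 0 0 Q.
have DE : D^T *m (B'^T *m y' *m B') *m D = B^T *m y *m B.
  rewrite BE BE' /D tr_block_mx !mulmx_block !trmx0.
  by rewrite !(mul0mx, mulmx0, addr0, add0r) PE QE.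
have uD : D \in unitmx by rewrite unitmxE det_ublock unitrM -!unitmxE uP.
exists (B' *m D *m invmx B); split.
- by rewrite !unitmx_mul uB' uD unitmx_inv.
- have -> : (B' *m D *m invmx B)^T *m y' *m (B' *m D *m invmx B) =
     (invmx B)^T *m (D^T *m (B'^T *m y' *m B') *m D) *m invmx B.
    by rewrite !trmx_mul !mulmxA.
  by rewrite DE !mulmxA mulmxK // -trmx_mul mulmxV // trmx1 mul1mx.
have BE1 : E = B *m col_mx 1%:M 0 by rewrite mul_row_col mulmx1 mulmx0 addr0.
rewrite {1}BE1 mulmxA mulmxKV // -mulmxA mul_block_col !(mulmx0, mul0mx, addr0) mulmx1.
by rewrite mul_row_col mulmx0 addr0 colspan_mul_unit.
Qed.

Lemma invmx_mul n (A B : 'M[R]_n) : A \in unitmx -> B \in unitmx ->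
  invmx (A *m B) = invmx B *m invmx A.
Proof.
move=> uA uB; have uAB : A *m B \in unitmx by rewrite unitmx_mul uA.
apply: (can_inj (mulKmx uAB)); rewrite mulmxV //.
by rewrite !mulmxA mulmxK // mulmxV.
Qed.

Lemma sym_inv n (z : 'M[R]_n) : z^T = z -> (invmx z)^T = invmx z.
Proof. by move=> sz; rewrite trmx_inv sz. Qed.

Lemma signature_inv n (z : 'M[R]_n) : z^T = z -> z \in unitmx ->
  signature (invmx z) = signature z.
Proof.
move=> sz uz; have uV : invmx z \in unitmx by rewrite unitmx_inv.
by rewrite -(sylvester sz uV) sym_inv // mulVmx // mul1mx.
Qed.

Lemma signature_unit n (z : 'M[R]_n) p q : z^T = z -> signature z = (p, q) ->
  (p + q)%N = n -> z \in unitmx.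
Proof. by move=> sz zE pq; rewrite -signature_sum // zE /= pq. Qed.

(** The inverse of a z a^T is a^-T z^-1 a^-1, whose matrix in the basis a E is
    that of z^-1 in the basis E. *)
Lemma Lact_Opqst n d (a : Defs.GL R n) (x : X R n d) p q s t : (p + q)%N = n ->
  @Opqst R n d p q s t x -> @Opqst R n d p q s t (Lact a x).
Proof.
move=> pq [z [sz zE rE xE]]; have ua := Defs.GL_unit a.
have uz := signature_unit sz zE pq.
exists (val a *m z *m (val a)^T); split.
- by rewrite !trmx_mul trmxK sz mulmxA.
- have := sylvester (P := (val a)^T) sz; rewrite trmxK unitmx_tr => ->//.
- rewrite -rE /=; have [E fE ->] := colspan_ex (eqP (valP x.2)).
  have sV := sym_inv sz.
  have fa : row_free (val a *m E)^T.
    by rewrite trmx_mul /row_free mxrankMfree // row_free_unit unitmx_tr.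
  rewrite mximg_colspan // !restr_signature_colspan //; last first.
    by rewrite sym_inv // !trmx_mul trmxK sz mulmxA.
  congr signature.
  rewrite !invmx_mul ?unitmx_mul ?unitmx_tr ?ua ?uz // trmx_mul !mulmxA.
  by rewrite mulmxK ?unitmx_tr // mulmxKV.
by rewrite /= xE levi_lambda.
Qed.

(** [flag_congr] gives a with a xi = xi' that transports z^-1 to z'^-1, hence
    z to z' = a z a^T. *)
Lemma Opqst_Lorbit d m (x : X R (d + m) d) p q s t :
  (p + q)%N = (d + m)%N -> (s + t)%N = d ->
  @Opqst R (d + m) d p q s t x -> @Opqst R (d + m) d p q s t = Lorbit x.
Proof.
move=> pq st Ox; apply/seteqP; split => [x'|_ [a _ <-]]; last exact: Lact_Opqst.
case: Ox => [z [sz zE rE xE]] [z' [sz' zE' rE' xE']].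
have uz := signature_unit sz zE pq; have uz' := signature_unit sz' zE' pq.
have [E fE EE] := colspan_ex (eqP (valP x.2)).
have [E' fE' EE'] := colspan_ex (eqP (valP x'.2)).
have sV := sym_inv sz; have sV' := sym_inv sz'.
move: rE rE'; rewrite EE EE' !restr_signature_colspan // => rE rE'.
have uV : invmx z \in unitmx by rewrite unitmx_inv.
have VV : signature (invmx z) = signature (invmx z') by rewrite !signature_inv // zE.
have uG : E^T *m invmx z *m E \in unitmx.
  by rewrite -signature_sum ?sym_congr // rE /= st.
have GG : signature (E^T *m invmx z *m E) = signature (E'^T *m invmx z' *m E').
  by rewrite rE.
have [a [ua ay aE]] := flag_congr sV sV' uV VV fE fE' uG GG.
pose g : Defs.GL R (d + m) := SigSub (@mem_set _ (Defs.GL R (d + m)) a ua).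
exists g => //; apply: injective_projections; apply/val_inj; last first.
  by rewrite EE' -aE /= EE mximg_colspan.
transitivity (lambda (val g *m z *m (val g)^T)); first by rewrite -levi_lambda -xE.
rewrite xE' /=; congr lambda.
rewrite -[z]invmxK -ay !invmx_mul ?unitmx_mul ?unitmx_tr ?unitmx_inv ?ua ?uz' //.
by rewrite invmxK !mulmxA mulmxV // mul1mx mulmxKV ?unitmx_tr.
Qed.

Definition signs k s : 'rV[R]_k := \row_i (if (i < s)%N then 1 else -1).

Lemma signature_signs k s : (s <= k)%N ->
  signature (diag_mx (signs k s)) = (s, (k - s)%N).
Proof.
move=> sk; rewrite (@signature_diag _ _ 1%:M _ (signs k s)); last 2 first.
- by rewrite trmx1 mulmx1.
- by rewrite trmx1 mulmx1 mul1mx.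
have E1 : #|[pred i : 'I_k | (i < s)%N]| = s.
  by rewrite -sum1_card (big_ord_narrow sk) sum1_card card_ord.
congr (_, _).
  rewrite -[RHS]E1; apply: eq_card => i; rewrite !inE mxE.
  by case: ifP; rewrite ?ltr01 // oppr_gt0 ltr10.
have := cardC [pred i : 'I_k | (i < s)%N]; rewrite E1 card_ord => E2.
transitivity #|[predC [pred i : 'I_k | (i < s)%N]]|; last first.
  by rewrite -[X in (X - _)%N]E2 addKn.
apply: eq_card => i; rewrite !inE mxE.
by case: ifP; rewrite ?oppr_lt0 ?ltr01 ?ltr10.
Qed.

Lemma signs_sqr k s : diag_mx (signs k s) *m diag_mx (signs k s) = 1%:M.
Proof.
rewrite mul_diag_mx; apply/matrixP => i j; rewrite !mxE.
by case: eqP => [->|]; rewrite ?mulr0 // !mulr1n; case: ifP; rewrite ?mulrNN mulr1.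
Qed.

(** The witness z is diagonal with s and p - s entries 1 in its two blocks and
    entries -1 elsewhere, so z^-1 = z; xi is spanned by the first d basis
    vectors. *)
Lemma Opqst_neq0 d m p q s t : (p + q)%N = (d + m)%N -> (s + t)%N = d ->
  (s <= p)%N -> (t <= q)%N -> exists x, @Opqst R (d + m) d p q s t x.
Proof.
move=> pq st sp tq.
pose D1 := diag_mx (signs d s); pose D2 := diag_mx (signs m (p - s)).
pose z := block_mx D1 0 0 D2.
have sz : z^T = z by rewrite /z tr_block_mx !tr_diag_mx !trmx0.
have zz : z *m z = 1%:M.
  rewrite /z mulmx_block !(mulmx0, mul0mx, addr0, add0r) !signs_sqr.
  by rewrite -scalar_mx_block.
have uz : z \in unitmx by have [] := mulmx1_unit zz.
have zV : invmx z = z by rewrite -[LHS]mulmx1 -zz mulmxA mulVmx // mul1mx.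
have sz2 : signature z = (p, q).
  rewrite signature_block ?tr_diag_mx // !signature_signs; [|lia|lia].
  by rewrite /=; congr (_, _); lia.
pose E : 'M[R]_(d + m, d) := col_mx 1%:M 0.
have fE : row_free E^T.
  apply/row_freeP; exists E.
  by rewrite /E tr_col_mx mul_row_col trmx0 mulmx0 addr0 trmx1 mulmx1.
have Ll : is_lagrangian (lambda z).
  by apply: colspan_lagrangian; [exact: col_mx1_free|rewrite sz trmx1 mulmx1 mul1mx].
have dE : \dim (colspan E) == d by rewrite dim_colspan.
exists (Sub (lambda z) (asboolT Ll), Sub (colspan E) dE), z; split => //=.
rewrite zV restr_signature_colspan // /E tr_col_mx trmx0 trmx1 mul_row_block mul_row_col.
rewrite !(mulmx0, mul0mx, addr0, add0r, mul1mx, mulmx1) signature_signs; last lia.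
by congr (_, _); lia.
Qed.

End Orbits.

(** * O(p,q;s,t) is open *)

(** Openness in a matrix group can be tested on all nearby matrices, without
    first making them elements of the group. *)
Lemma open_subtypeP (X : topologicalType) (A : set X) (S : set A) :
  open S <-> (forall a, S a -> \forall x \near val a, forall b : A, val b = x -> S b).
Proof.
split=> [[U oU <-] a Ua|H].
  apply: (@filterS _ (nbhs (val a)) _ U); last by apply: open_nbhs_nbhs; split.
  by move=> x Ux b bx; rewrite /= /set_val /= bx.
rewrite openE => a Sa; have := H a Sa; rewrite /prop_near1 nbhsE => -[U [oU Ua] US].
exists (set_val @^-1` U); split => //=; first by exists U.
by move=> b /US; exact.
Qed.

Section Openness.
Context {R : realType}.

Lemma cvg_ulsubmx n (g : 'M[R]_(n + n)) : ulsubmx M @[M --> g] --> ulsubmx g.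
Proof.
apply: (@cvg_mx _ _ (nbhs g)) => i j; rewrite !mxE; under eq_cvg do rewrite !mxE.
exact: coord_continuous.
Qed.

Lemma cvg_dlsubmx n (g : 'M[R]_(n + n)) : dlsubmx M @[M --> g] --> dlsubmx g.
Proof.
apply: (@cvg_mx _ _ (nbhs g)) => i j; rewrite !mxE; under eq_cvg do rewrite !mxE.
exact: coord_continuous.
Qed.

Lemma base_colspan n (g : Sp R n) : val (lagr_act g (lagr_base R n)) =
  colspan (col_mx (ulsubmx (val g)) (dlsubmx (val g))).
Proof.
rewrite /= /Vplus -/(colspan _) mximg_colspan -{1}[val g]submxK mul_block_col.
by rewrite !mulmx1 !mulmx0 !addr0.
Qed.

Lemma base_free n (g : Sp R n) :
  row_free (col_mx (ulsubmx (val g)) (dlsubmx (val g)))^T.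
Proof.
have [ug _] : Sp R n (val g) by exact: set_mem (valP g).
have -> : col_mx (ulsubmx (val g)) (dlsubmx (val g)) = val g *m col_mx 1%:M 0.
  by rewrite -{3}[val g]submxK mul_block_col !mulmx1 !mulmx0 !addr0.
rewrite trmx_mul /row_free mxrankMfree ?row_free_unit ?unitmx_tr //.
apply/row_freeP; exists (col_mx 1%:M 0).
by rewrite tr_col_mx mul_row_col trmx0 mulmx0 addr0 trmx1 mulmx1.
Qed.

(** If g has left half (A; C), then g V^+ = lambda_w exactly when C is
    invertible and w = A C^-1, an open condition and a continuous function of
    g.  Symmetry of w is automatic, since g V^+ is Lagrangian. *)
Lemma open_lambda n (N : set 'M[R]_n) : open N ->
  open [set U : lagr R n | exists w, [/\ w^T = w, N w & val U = lambda w]].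
Proof.
move=> oN; apply/open_subtypeP => g [w [sw Nw]].
rewrite base_colspan => /(lambda_colspan (base_free g))[uC wE].
have cC := @cvg_dlsubmx n (val g).
have nC : \forall M \near val g, dlsubmx M \in unitmx := cC _ (near_unit uC).
have cw : ulsubmx M *m invmx (dlsubmx M) @[M --> val g] --> w.
  rewrite -wE; apply: (@cvg_mulmx _ _ (nbhs (val g))); first exact: cvg_ulsubmx.
  exact: (@cvg_invmx _ _ (nbhs (val g))).
have nN : \forall M \near val g, N (ulsubmx M *m invmx (dlsubmx M)) :=
  cw _ (open_nbhs_nbhs (conj oN Nw)).
apply: (@filterS _ (nbhs (val g))) (filterI nC nN) => M [uM NM] h hM.
exists (ulsubmx M *m invmx (dlsubmx M)); split => //; last first.
  by rewrite base_colspan hM colspan_lambda.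
apply: lambda_lagr_sym; rewrite -colspan_lambda // -hM -base_colspan.
by have /asboolP := valP (lagr_act h (lagr_base R n)).
Qed.

(** If a xi = b U, with U the span of E, then a' xi = (a' a^-1 b) U, and
    a' a^-1 b is near b for a' near a. *)
Lemma open_translates n d (E : 'M[R]_(n, d)) (N : set 'M[R]_n) : open N ->
  open [set xi : grass R d n |
    exists b, [/\ b \in unitmx, N b & val xi = colspan (b *m E)]].
Proof.
move=> oN; set S := (S in open S); suff: grass_open S by [].
move=> xi; apply/open_subtypeP => a [b [ub Nb aE]].
have ua := Defs.GL_unit a.
have cb : M *m (invmx (val a) *m b) @[M --> val a] --> b.
  rewrite -[X in _ --> X](mulKVmx ua b).
  apply: (@cvg_mulmx _ _ (nbhs (val a))); first exact: cvg_id.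
  exact: cvg_cst.
have nN : \forall M \near val a, N (M *m (invmx (val a) *m b)) :=
  cb _ (open_nbhs_nbhs (conj oN Nb)).
apply: (@filterS _ (nbhs (val a))) nN => M NM c cM.
have [F fF xiF] := colspan_ex (eqP (valP xi)).
exists (M *m (invmx (val a) *m b)); split => //.
  by rewrite !unitmx_mul unitmx_inv ua ub -cM Defs.GL_unit.
move: aE; rewrite /= xiF !mximg_colspan cM => aE.
have := congr1 (fun U => mximg (M *m invmx (val a)) U) aE.
by rewrite /= !mximg_colspan !mulmxA mulmxKV.
Qed.

Lemma Opqst_open n d p q s t : (p + q)%N = n -> (s + t)%N = d ->
  open (@Opqst R n d p q s t).
Proof.
move=> pq st; rewrite openE => x [z [sz zE rE xE]].
have uz := signature_unit sz zE pq; have sV := sym_inv sz.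
have [E fE EE] := colspan_ex (eqP (valP x.2)).
move: rE; rewrite EE restr_signature_colspan // => rE.
(* The matrix of w^-1 restricted to the span of b E, in the basis b E. *)
pose f (wb : 'M[R]_n * 'M[R]_n) := (wb.2 *m E)^T *m invmx wb.1 *m (wb.2 *m E).
have fz : f (z, 1%:M) = E^T *m invmx z *m E by rewrite /f /= mul1mx.
pose F := filter_prod (nbhs z) (nbhs (1%:M : 'M[R]_n)).
have FF : Filter F by exact: filter_prod_filter.
have cf : f wb @[wb --> F] --> f (z, 1%:M).
  have c1 : wb.1 @[wb --> F] --> z by exact: cvg_fst.
  have c2 : wb.2 *m E @[wb --> F] --> 1%:M *m E.
    by apply: (@cvg_mulmx _ _ F); [exact: cvg_snd|exact: cvg_cst].
  apply: (@cvg_mulmx _ _ F) => //.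
  apply: (@cvg_mulmx _ _ F); last exact: cvg_invmx.
  apply: cvg_mx => i j; rewrite mxE; under eq_cvg do rewrite mxE.
  exact: cvg_entry.
have n1 : \forall w \near z, w^T = w -> signature w = (p, q).
  by rewrite -zE; exact: signature_near.
have n2 : \forall M \near f (z, 1%:M), M^T = M -> signature M = (s, t).
  rewrite -rE -fz; apply: signature_near; first by rewrite fz sym_congr.
  by rewrite fz -signature_sum ?sym_congr // rE /= st.
have [[P1 P2] [/= zP1 P2z] P12] := cf _ n2.
pose N1 := (P1 `&` [set w | w^T = w -> signature w = (p, q)]
               `&` [set w | w \in unitmx])°.
pose N2 := P2°.
exists ([set U : lagr R n | exists w, [/\ w^T = w, N1 w & val U = lambda w]],
  [set xi : grass R d n | exists b, [/\ b \in unitmx, N2 b & val xi = colspan (b *m E)]]).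
  split; apply: open_nbhs_nbhs; split.
  - exact/open_lambda/open_interior.
  - exists z; split => //.
    by apply: filterI; [exact: filterI|exact: near_unit].
  - exact/open_translates/open_interior.
  - by exists 1%:M; split; rewrite ?unitmx1 ?mul1mx.
move=> [U xi] [/= [w [sw /interior_subset[[P1w pqw] uw] Uw]]].
move=> [b [ub /interior_subset P2b xib]].
exists w; split => //=; first exact: pqw.
rewrite xib restr_signature_colspan ?sym_inv //; last first.
  by rewrite trmx_mul /row_free mxrankMfree // row_free_unit unitmx_tr.
by have := P12 (w, b) (conj P1w P2b); apply; rewrite sym_congr ?sym_inv.
Qed.

End Openness.

(** * Symplectic shears and general position *)

Section Generic.
Context {R : realType}.

(** The topology on Lagrangians comes from the orbit map of V^+, so U is first
    written as g V^+, and the curve u r * g then passes through g in Sp. *)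
Lemma lagr_perturb n (U : lagr R n) (W : set (lagr R n)) (u : R -> 'M[R]_(n + n)) :
  nbhs U W -> (forall r, u r \in Sp R n) ->
  u r @[r --> (0 : R)] --> (1%:M : 'M[R]_(n + n)) ->
  \forall r \near (0 : R), forall U' : lagr R n, val U' = mximg (u r) (val U) -> W U'.
Proof.
move=> UW Su cu; have [g gU] := lagr_transitive U.
move: UW; rewrite nbhsE => -[V [oV UV] VW].
have oVg : open [set h : Sp R n | V (lagr_act h (lagr_base R n))] by exact: oV.
move/open_subtypeP/(_ g): oVg; rewrite /= -gU => /(_ UV) nV.
have cug : u r *m val g @[r --> (0 : R)] --> val g.
  rewrite -[X in _ --> X]mul1mx.
  by apply: (@cvg_mulmx _ _ (nbhs (0 : R))); [exact: cu|exact: cvg_cst].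
have {}nV : \forall r \near (0 : R), forall h : Sp R n, val h = u r *m val g ->
  V (lagr_act h (lagr_base R n)) := cug _ nV.
apply: (@filterS _ (nbhs (0 : R))) nV => r Vr U' U'E; apply: VW.
have ug : u r *m val g \in Sp R n.
  have [ur Jr] := set_mem (Su r); have [ug Jg] := set_mem (valP g).
  by apply/mem_set; split=> [|v w]; rewrite ?unitmx_mul ?ur // -!mulmxA Jr Jg.
suff -> : U' = lagr_act (SigSub ug) (lagr_base R n) by exact: Vr.
apply: val_inj; transitivity (mximg (u r) (val U)); first exact: U'E.
by rewrite gU /= /Vplus -/(colspan _) !mximg_colspan mulmxA.
Qed.

Lemma Sp_upper n (S : 'M[R]_n) : S^T = S -> block_mx 1%:M S 0 1%:M \in Sp R n.
Proof.
move=> sS; apply: Sp_congr; rewrite /Jmx tr_block_mx !trmx0 trmx1 sS !mulmx_block.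
rewrite !(mulmx0, mul0mx, mulmx1, mul1mx, addr0, add0r, mulmxN, mulNmx, oppr0).
by rewrite ?addNr ?subrr.
Qed.

Lemma Sp_lower n (S : 'M[R]_n) : S^T = S -> block_mx 1%:M 0 S 1%:M \in Sp R n.
Proof.
move=> sS; apply: Sp_congr; rewrite /Jmx tr_block_mx !trmx0 trmx1 sS !mulmx_block.
rewrite !(mulmx0, mul0mx, mulmx1, mul1mx, addr0, add0r, mulmxN, mulNmx, oppr0).
by rewrite ?addNr ?subrr.
Qed.

Lemma cvg_shear n (S T : 'M[R]_n) :
  block_mx 1%:M (r *: S) (r *: T) 1%:M @[r --> (0 : R)] --> (1%:M : 'M[R]_(n + n)).
Proof.
(* The shear is affine in r. *)
have bE r : block_mx 1%:M (r *: S) (r *: T) 1%:M =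
    1%:M + r *: block_mx 0 S T 0 :> 'M[R]_(n + n).
  by rewrite scale_block_mx !scaler0 scalar_mx_block add_block_mx !add0r !addr0.
under eq_cvg do rewrite bE.
apply: (@cvg_mx _ _ (nbhs (0 : R))) => i j; under eq_cvg do rewrite mxE [X in _ + X]mxE.
set a := (1%:M : 'M[R]_(n + n)) i j; set b := block_mx 0 S T 0 i j.
suff : a + r * b @[r --> (0 : R)] --> a + 0 * b by rewrite mul0r addr0.
apply: cvgD; first exact: cvg_cst.
by apply: cvgM; [exact: cvg_id|exact: cvg_cst].
Qed.

(** Take S = k^T k with k vanishing exactly on the column space of A.  If
    A x + r S C x = 0, the two terms are orthogonal, so both vanish.  Then C x
    lies in the column space of A, say C x = A t, and
    |C x|^2 = x^T C^T A t = (A x)^T C t = 0 by A^T C = C^T A.  So x is in the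
    kernel of A and of C, and x = 0. *)
Lemma coker_shear n (A C : 'M[R]_n) : row_free (col_mx A C)^T ->
  A^T *m C = C^T *m A ->
  exists2 S : 'M[R]_n, S^T = S & forall r, r != 0 -> A + r *: (S *m C) \in unitmx.
Proof.
move=> fF AC; pose k := (cokermx A^T)^T.
have kA : k *m A = 0 by rewrite -[A]trmxK -trmx_mul mulmx_coker trmx0.
exists (k^T *m k) => [|r r0]; first by rewrite trmx_mul trmxK.
rewrite -unitmx_tr -row_free_unit -kermx_eq0; apply/rowV0P => x /sub_kermxP.
move=> /(congr1 trmx); rewrite trmx_mul trmxK trmx0; move: x^T (@trmxK _ _ _ x) => v vx.
rewrite mulmxDl -scalemxAl => e.
have skC : k^T *m (k *m C *m v) = 0.
  set w := k^T *m _.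
  have wA : w^T *m (A *m v) = 0.
    by rewrite /w trmx_mul trmxK mulmxA -(mulmxA _ k A) kA mulmx0 mul0mx.
  have : w^T *m (A *m v + r *: (k^T *m k *m C *m v)) = 0 by rewrite e mulmx0.
  rewrite mulmxDr wA add0r -scalemxAr -!mulmxA -/w !mulmxA => /eqP.
  rewrite scaler_eq0 (negPf r0) /= -!mulmxA => /eqP w0; apply/eqP.
  by rewrite -dot_eq0 /w !mulmxA -!mulmxA in w0 *; rewrite -/w w0 mxE.
have Av : A *m v = 0.
  by move: e; rewrite -!mulmxA (mulmxA k) skC scaler0 addr0.
have kCv : k *m (C *m v) = 0.
  apply/eqP; rewrite -dot_eq0 trmx_mul -mulmxA mulmxA.
  by rewrite -!mulmxA (mulmxA k C) skC !mulmx0 mxE.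
have /submxP[D CvD] : ((C *m v)^T <= A^T)%MS.
  by rewrite submxE -[cokermx _]trmxK -/k -trmx_mul kCv trmx0.
have Cv : C *m v = 0.
  apply/eqP; rewrite -dot_eq0 {1}CvD -mulmxA (mulmxA A^T) AC -mulmxA Av !mulmx0.
  by rewrite mxE.
apply: (row_free_inj fF); rewrite mul0mx -vx -trmx_mul mul_col_mx Av Cv.
by rewrite col_mx0 trmx0.
Qed.

(** There are more points e/2, e/3, ... than roots. *)
Lemma nonroot_near (P : set R) (p : {poly R}) : nbhs (0 : R) P -> p != 0 ->
  exists2 r, P r & ~~ root p r.
Proof.
move=> /nbhs_ballP[e /= e0 eP] p0.
pose rs := [seq e / (i.+2)%:R | i <- iota 0 (size p)].
have urs : uniq rs.
  rewrite map_inj_uniq ?iota_uniq // => i j /(mulfI (lt0r_neq0 e0)) /invr_inj.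
  by move=> /(mulrIn (oner_neq0 R)) [].
have := contraNN (fun x => max_poly_roots p0 x urs).
rewrite size_map size_iota ltnn => /(_ isT) /allPn[a /mapP[i _ ->] na].
exists (e / (i.+2)%:R) => //; apply: eP.
rewrite /ball /= sub0r normrN gtr0_norm ?divr_gt0 ?ltr0n //.
by rewrite ltr_pdivrMr ?ltr0n // ltr_pMr // ltr1n.
Qed.

(** N + r K = (r + N K^-1) K, so r makes it singular exactly when r is an
    eigenvalue of - N K^-1. *)
Lemma unit_pencil n (N K : 'M[R]_n) r : K \in unitmx ->
  (N + r *: K \in unitmx) = ~~ root (char_poly (- (N *m invmx K))) r.
Proof.
move=> uK; have -> : N + r *: K = - (- (N *m invmx K) - r%:M) *m K.
  by rewrite opprD !opprK mulmxDl mulmxKV // mul_scalar_mx.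
rewrite unitmx_mul uK andbT -eigenvalue_root_char /eigenvalue /eigenspace.
rewrite kermx_eq0 negbK row_free_unit.
by rewrite -scaleN1r unitmxZ // unitrN unitr1.
Qed.

End Generic.

(** * Open orbits are in general position *)

Section OpenOrbits.
Context {R : realType}.

(** Only the Lagrangian is moved to reach general position; the subspace xi
    stays fixed. *)
Lemma open_slice n d (O : set (X R n d)) (x : X R n d) : open O -> O x ->
  nbhs x.1 [set U | O (U, x.2)].
Proof.
move=> oO Ox; have : nbhs x O by apply: open_nbhs_nbhs; split.
move=> [[P Q] /= [Px Qx] PQ]; apply: (@filterS _ (nbhs x.1)) Px => U PU.
by apply: PQ; split => //=; exact: nbhs_singleton.
Qed.

Lemma open_shear n d (O : set (X R n d)) (x : X R n d) (S T : 'M[R]_n) :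
  open O -> O x ->
  (forall r : R, block_mx 1%:M (r *: S) (r *: T) 1%:M \in Sp R n) ->
  \forall r \near (0 : R), forall U, val U =
     mximg (block_mx 1%:M (r *: S) (r *: T) 1%:M) (val x.1) -> O (U, x.2).
Proof.
move=> oO Ox uS.
exact: (lagr_perturb (open_slice oO Ox) uS (cvg_shear S T)).
Qed.

Lemma lagr_mximg_ex n (g : 'M[R]_(n + n)) (U : lagr R n) : g \in Sp R n ->
  exists U' : lagr R n, val U' = mximg g (val U).
Proof. by move=> gS; exists (lagr_act (SigSub gS) U). Qed.

(** The upper shear makes the first component a coordinate on the Lagrangian,
    which becomes {(x, y x)} with y symmetric; the lower shear replaces y by
    y + r.  For all but finitely many r both y + r and its restriction to the
    span of E are nondegenerate, and the Lagrangian is lambda_z for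
    z = (y + r)^-1. *)
Lemma open_generic n d (O : set (X R n d)) (x : X R n d) : open O -> O x ->
  exists z : 'M[R]_n, exists E : 'M[R]_(n, d), exists y : X R n d,
    [/\ [/\ O y, z^T = z & z \in unitmx], row_free E^T,
        E^T *m invmx z *m E \in unitmx, val y.1 = lambda z & val y.2 = colspan E].
Proof.
move=> oO Ox; have [E fE xE] := colspan_ex (eqP (valP x.2)).
have [A [C [fAC xAC AC]]] := lagr_basis x.1.
have [S sS uS] := coker_shear fAC AC.
have SpS (r : R) : block_mx 1%:M (r *: S) (r *: 0) 1%:M \in Sp R n.
  by rewrite scaler0; apply: Sp_upper; rewrite linearZ /= sS.
have /nbhs_ballP[e /= e0 eO] := open_shear oO Ox SpS.
(* Every nonzero parameter works; e / 2 is one inside the ball. *)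
have e20 : e / 2 != 0 by rewrite lt0r_neq0 // divr_gt0.
have [U1 U1E] := lagr_mximg_ex x.1 (SpS (e / 2)).
have O1 : O (U1, x.2).
  apply: eO U1E; rewrite /ball /= sub0r normrN gtr0_norm ?divr_gt0 //.
  by rewrite ltr_pdivrMr // ltr_pMr // ltr1n.
set B := A + (e / 2) *: (S *m C); have uB : B \in unitmx := uS _ e20.
pose y := C *m invmx B.
have U1y : val U1 = colspan (col_mx 1%:M y).
  rewrite U1E xAC mximg_colspan mul_block_col !mul1mx scaler0 mul0mx add0r -scalemxAl -/B.
  by rewrite -(colspan_mul_unit (col_mx 1%:M y) uB) mul_col_mx mul1mx mulmxKV.
have sy : y^T = y.
  have /asboolP := valP U1; rewrite U1y => /lagrangian_form.
  rewrite Jmx_form trmx1 mul1mx mulmx1 => /eqP.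
  by rewrite subr_eq0 => /eqP.
have SpT (r : R) : block_mx 1%:M (r *: 0) (r *: 1%:M) 1%:M \in Sp R n.
  by rewrite scaler0; apply: Sp_lower; rewrite linearZ /= trmx1.
have nO := open_shear oO O1 SpT.
(* The roots of p1 and p2 are the r at which y + r, respectively its
   restriction to the span of E, is degenerate. *)
pose p1 := char_poly (- (y *m invmx 1%:M)).
pose p2 := char_poly (- (E^T *m y *m E *m invmx (E^T *m E))).
have p0 : p1 * p2 != 0 by rewrite mulf_neq0 ?monic_neq0 ?char_poly_monic.
have [r rO] := nonroot_near nO p0.
rewrite rootM negb_or /p1 /p2 -!unit_pencil ?unitmx1 ?gram_unit // => /andP[uy uEy].
set w := y + r *: 1%:M in uy.
have sw : w^T = w by rewrite /w linearD linearZ /= sy trmx1.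
have [U2 U2E] := lagr_mximg_ex U1 (SpT r).
exists (invmx w), E, (U2, x.2); split => //.
- by split; [exact: rO|exact: sym_inv|rewrite unitmx_inv].
- by rewrite invmxK /w mulmxDr mulmxDl -scalemxAr -scalemxAl mulmx1.
rewrite /= U2E U1y mximg_colspan mul_block_col !mul1mx scaler0 mul0mx addr0 mulmx1.
by rewrite addrC -/w colspan_lambda // mul1mx.
Qed.

Lemma mximg_inv n (g h : 'M[R]_n) (U : {vspace 'cV[R]_n}) : h *m g = 1%:M ->
  mximg h (mximg g U) = U.
Proof. by move=> hg; rewrite -[U]colspan_basis_mx !mximg_colspan mulmxA hg mul1mx. Qed.

Lemma Lact_inv n d (a : Defs.GL R n) : exists b : Defs.GL R n,
  forall x : X R n d, Lact b (Lact a x) = x.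
Proof.
have ua := Defs.GL_unit a; have ub : invmx (val a) \in unitmx by rewrite unitmx_inv.
exists (SigSub (@mem_set _ (Defs.GL R n) _ ub)) => -[U xi].
apply: injective_projections; apply/val_inj; apply: mximg_inv => /=; last exact: mulVmx.
rewrite mulmx_block !(mulmx0, mul0mx, addr0, add0r) mulVmx // trmx_inv invmxK.
by rewrite mulmxV ?unitmx_tr // -scalar_mx_block.
Qed.

End OpenOrbits.

Theorem theorem4p3 (R : realType) (n d : nat) (hd : (1 <= d <= n - 1)%N) :
  (forall p q s t : nat,
     (p + q = n)%N -> (s + t = d)%N -> (s <= p)%N -> (t <= q)%N ->
     is_open_Lorbit (@Opqst R n d p q s t)) /\
  (forall O : set (X R n d), is_open_Lorbit O ->
     exists p q s t : nat,
       [/\ (p + q = n)%N, (s + t = d)%N, (s <= p)%N, (t <= q)%N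
         & O = @Opqst R n d p q s t]).
Proof.
have [m nE] : exists m, n = (d + m)%N by exists (n - d)%N; lia.
subst n; split=> [p q s t pq st sp tq|O [oO [x0 OE]]].
  split; first exact: Opqst_open.
  have [x Ox] := @Opqst_neq0 R _ _ _ _ _ _ pq st sp tq.
  by exists x; exact: Opqst_Lorbit.
have u1 : (1%:M : 'M[R]_(d + m)) \in unitmx by exact: unitmx1.
pose g1 : Defs.GL R (d + m) := SigSub (@mem_set _ (Defs.GL R (d + m)) _ u1).
have Ox1 : O (Lact g1 x0) by rewrite OE; exists g1.
have [z [E [y [[Oy sz uz] fE uE yz yE]]]] := open_generic oO Ox1.
have sV := sym_inv sz.
have pq : ((signature z).1 + (signature z).2 = d + m)%N.
  by apply/eqP; rewrite signature_sum.
have st : ((signature (E^T *m invmx z *m E)).1 +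
           (signature (E^T *m invmx z *m E)).2 = d)%N.
  by apply/eqP; rewrite signature_sum ?sym_congr.
have [sp tq] := inertia_le E sV; rewrite signature_inv // in sp tq.
exists (signature z).1, (signature z).2, (signature (E^T *m invmx z *m E)).1,
  (signature (E^T *m invmx z *m E)).2; split => //.
have Py : @Opqst R (d + m) d (signature z).1 (signature z).2
    (signature (E^T *m invmx z *m E)).1 (signature (E^T *m invmx z *m E)).2 y.
  exists z; split => //.
  by rewrite yE restr_signature_colspan // [LHS]surjective_pairing.
(* The orbit of x0 contains y, and O(p,q;s,t) is stable under the action, so
   it contains x0 and is the orbit of x0. *)
move: Oy; rewrite OE => -[a _ ay].
have [b ba] := Lact_inv d a.
have Px0 := Lact_Opqst b pq Py.
by rewrite -ay ba in Px0; rewrite (Opqst_Lorbit pq st Px0).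
Qed.
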